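(* For all $\nu,\nu'\in\mathbb N^I$ there is a bijection $$\otimes:\ \operatorname{Irr}\mathfrak L(\nu,\lambda)\times\operatorname{Irr}\mathfrak L(\nu',\lambda')\ \xrightarrow{\ \sim\ }\ \operatorname{Irr}\widetilde{\mathfrak Z}(\nu,\nu'),$$ induced by the map sending $[x,f,g]\in\widetilde{\mathfrak Z}(\nu,\nu')$ to the pair of classes of the maps induced by $(x,f)$ on $V$ (with values in $V$ and $W$) and on $V_{\nu+\nu'}/V$ (with values in $V_{\nu+\nu'}/V$ and $(W\oplus W')/W$), where $V=V(x,f,g)$.
   Context: $Q=(I,\Omega)$ is an arbitrary finite quiver, possibly with loops; $h\in\Omega$ goes from $s(h)$ to $t(h)$, $\bar h$ is the opposite arrow, $H=\Omega\sqcup\bar\Omega$, $\epsilon=1$ on $\Omega$ and $-1$ on $\bar\Omega$. $V_\nu$ denotes a fixed $I$-graded $\mathbb C$-vector space of dimension $\nu\in\mathbb N^I$. For an $I$-graded space $W$ of dimension $\lambda$, $E_{\nu,\lambda}$ is the space of triples $(x,f,g)$ with $x\in\bar E_\nu=\bigoplus_{h\in H}\operatorname{Hom}((V_\nu)_{s(h)},(V_\nu)_{t(h)})$, $f\in\bigoplus_i\operatorname{Hom}((V_\nu)_i,W_i)$, $g\in\bigoplus_i\operatorname{Hom}(W_i,(V_\nu)_i)$, and $\mathsf M_\circ(\nu,\lambda)$ is the zero locus of $\mu_{\nu,\lambda}(x,f,g)=\big(g_if_i+\sum_{h\in H,\,s(h)=i}\epsilon(h)x_{\bar h}x_h\big)_{i}$.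 A triple is stable if the only $x$-stable ($I$-graded) subspace of $\ker f$ is $\{0\}$; $\mathsf M(\nu,\lambda)$ is the stable locus of $\mathsf M_\circ(\nu,\lambda)$, on which $G_\nu=\prod_iGL_{\nu_i}(\mathbb C)$ acts freely, and $\mathfrak M(\nu,\lambda)=\mathsf M(\nu,\lambda)/G_\nu$. $x\in\bar E_\nu$ is seminilpotent if there is a flag $V_\nu=\mathsf W_0\supset\dots\supset\mathsf W_r=\{0\}$ of $I$-graded subspaces, each quotient $\mathsf W_k/\mathsf W_{k+1}$ being concentrated at a single vertex, with $x_h(\mathsf W_k)\subseteq\mathsf W_{k+1}$ for $h\in\Omega$ and $x_h(\mathsf W_k)\subseteq\mathsf W_k$ for $h\in\bar\Omega$. A pair $(x,f)$ is seminilpotent if $x$ is. $\mathsf L(\nu,\lambda)=\{(x,f,0)\in\mathsf M(\nu,\lambda)\mid x\text{ seminilpotent}\}$ and $\mathfrak L(\nu,\lambda)=\mathsf L(\nu,\lambda)/G_\nu$. Let $W,W'$ be $I$-graded spaces of dimensions $\lambda,\lambda'$; use $W\oplus W'$ as framing space of dimension $\lambda+\lambda'$. For $\mathbf v\in\mathbb N^I$, $\mathsf Z_\circ(\mathbf v)\subseteq\mathsf M_\circ(\mathbf v,\lambda+\lambda')$ is the set of $(x,f,g)$ for which there is an $I$-graded subspace $V\subseteq V_{\mathbf v}$ with $x(V)\subseteq V$, $f(V)\subseteq W$, $g(W\oplus W')\subseteq V$ and $g(W)=\{0\}$; $V(x,f,g)$ denotes the largest $x$-stable subspace of $f^{-1}(W)$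 containing $\operatorname{Im}g$. $\widetilde{\mathsf Z}_\circ(\mathbf v)$ is the set of $(x,f,g)\in\mathsf Z_\circ(\mathbf v)$ such that, with $V=V(x,f,g)$, the pairs induced by $(x,f)$ on $V$ (framing $W$) and on $V_{\mathbf v}/V$ (framing $(W\oplus W')/W\simeq W'$) are seminilpotent. $\widetilde{\mathsf Z}_\circ(\nu,\nu')=\{(x,f,g)\in\widetilde{\mathsf Z}_\circ(\nu+\nu')\mid\dim V(x,f,g)=\nu\}$, $\widetilde{\mathsf Z}(\nu,\nu')$ is its stable locus, and $\widetilde{\mathfrak Z}(\nu,\nu')=\widetilde{\mathsf Z}(\nu,\nu')/G_{\nu+\nu'}$. $\operatorname{Irr}$ denotes the set of irreducible components. *)

(* Defs.v *)
From HB Require Import structures.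
From mathcomp Require Import all_boot all_order all_algebra.
From mathcomp Require Import all_classical reals topology_structure quotient_topology.
From mathcomp Require Import complex mpoly.

Set Implicit Arguments.
Unset Strict Implicit.
Unset Printing Implicit Defensive.

Import GRing.Theory.
Local Open Scope classical_set_scope.
Local Open Scope ring_scope.

Section IrreducibleComponents.
Variable T : topologicalType.
Implicit Types X Y A B : set T.

Definition irreducible Y :=
  Y !=set0 /\
  forall A B, closed A -> closed B -> Y `<=` A `|` B -> Y `<=` A \/ Y `<=` B.

(* Irreducibility of a subset only depends on its subspace topology, so these
   are the irreducible components of Y as a subspace of T. *)
Definition Irr Y : set (set T) :=
  [set X | [/\ X `<=` Y, irreducible X &
     forall X', X' `<=` Y -> irreducible X' -> X `<=` X' -> X' = X]].

End IrreducibleComponents.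

Record quiver := Quiver {
  vertex : finType;
  arrow : finType;
  source : arrow -> vertex;
  target : arrow -> vertex
}.

Section DoubleQuiver.
Variable Q : quiver.

(* H = Omega + Omega-bar: inr a is the arrow opposite to inl a (two different
   elements of H even if a is a loop). *)
Definition darrow : finType := (arrow Q + arrow Q)%type.
Definition dsource (h : darrow) : vertex Q :=
  match h with inl a => source a | inr a => target a end.
Definition dtarget (h : darrow) : vertex Q :=
  match h with inl a => target a | inr a => source a end.
Definition bar (h : darrow) : darrow :=
  match h with inl a => inr a | inr a => inl a end.
Definition in_Omega (h : darrow) : bool := if h is inl _ then true else false.

(* Indexing the arrows of H by their end points avoids casts between matrix
   types in compositions such as x_(bar h) x_h. *)
Definition hom (i j : vertex Q) :=
  {h : darrow | (dsource h == i) && (dtarget h == j)}.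

Lemma bar_hom_subproof i j (h : hom i j) :
  (dsource (bar (val h)) == j) && (dtarget (bar (val h)) == i).
Proof. by case: h => [[a|a]] /= /andP[-> ->]. Qed.

Definition bar_hom i j (h : hom i j) : hom j i :=
  exist _ (bar (val h)) (bar_hom_subproof h).

Definition eps (K : pzRingType) i j (h : hom i j) : K :=
  if in_Omega (val h) then 1 else -1.

Definition dimvec := vertex Q -> nat.
Definition dadd (d e : dimvec) : dimvec := fun i => (d i + e i)%N.

End DoubleQuiver.

(* An I-graded space of dimension d has the row vectors 'rV_(d i) as its
   component at i, and linear maps act by right multiplication; hence the
   composite "first A, then B" is A *m B. A graded subspace is given by square
   matrices, whose row spaces are its components. *)
Section Representations.
Variables (K : fieldType) (Q : quiver).
Implicit Types nu la : dimvec Q.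

Definition drep nu := forall i j : vertex Q, hom i j -> 'M[K]_(nu i, nu j).

Definition graded_subspace nu := forall i : vertex Q, 'M[K]_(nu i).

(* The space E_{nu,la} *)
Record triple nu la := Triple {
  tx : drep nu;
  tf : forall i, 'M[K]_(nu i, la i);
  tg : forall i, 'M[K]_(la i, nu i)
}.

HB.instance Definition _ nu la := gen_eqMixin (triple nu la).
HB.instance Definition _ nu la := gen_choiceMixin (triple nu la).

Section Zariski.
Variables nu la : dimvec Q.

Definition entry_index : finType :=
  ({ij : vertex Q * vertex Q &
      (hom ij.1 ij.2 * ('I_(nu ij.1) * 'I_(nu ij.2)))%type} +
   ({i : vertex Q & ('I_(nu i) * 'I_(la i))%type} +
    {i : vertex Q & ('I_(la i) * 'I_(nu i))%type}))%type.

Definition entry (z : triple nu la) (c : entry_index) : K :=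
  match c with
  | inl (existT _ (h, (a, b))) => tx z h a b
  | inr (inl (existT i (a, b))) => tf z i a b
  | inr (inr (existT i (a, b))) => tg z i a b
  end.

Definition entries (z : triple nu la) : 'I_#|entry_index| -> K :=
  fun k => entry z (enum_val k).

Definition zero_locus (S : set {mpoly K[#|entry_index|]}) :
  set (triple nu la) := [set z | forall p, S p -> p.@[entries z] = 0].

Definition zariski_open : set_system (triple nu la) :=
  [set U | exists S, ~` U = zero_locus S].

Lemma zariski_openT : zariski_open setT.
Proof.
exists (fun p => p = 1); rewrite setCT; apply/seteqP; split => // z /= /(_ 1 erefl).
by rewrite meval1 => /eqP; rewrite oner_eq0.
Qed.

Lemma zariski_openI : setI_closed zariski_open.
Proof.
move=> A B [S AS] [S' BS'].
exists [set r | exists p q, [/\ S p, S' q & r = p * q]].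
rewrite setCI AS BS'; apply/seteqP; split => z.
  move=> [Sz|S'z] _ [p [q [Sp S'q ->]]]; rewrite mevalM.
    by rewrite (Sz p) ?mul0r.
  by rewrite (S'z q) ?mulr0.
move=> SS'z; have [|nSz] := pselect (zero_locus S z); [by left|right].
move=> q S'q; apply: contrapT => /eqP q0; apply: nSz => p Sp.
have /eqP : (p * q).@[entries z] = 0 by apply: SS'z; exists p, q.
by rewrite mevalM mulf_eq0 (negbTE q0) orbF => /eqP.
Qed.

Lemma zariski_open_bigU (J : Type) (f : J -> set (triple nu la)) :
  (forall j, zariski_open (f j)) -> zariski_open (\bigcup_j f j).
Proof.
move=> openf; exists [set p | exists j, forall z, ~ f j z ->
  p.@[entries z] = 0].
rewrite setC_bigcup; apply/seteqP; split => z /=.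
  by move=> nfz p [j]; apply; apply: nfz.
move=> fz j _; have [S fS] := openf j; rewrite fS => p Sp; apply: fz; exists j.
by move=> z' nfz'; have : (~` f j) z' by []; rewrite fS; apply.
Qed.

HB.instance Definition _ := @isOpenTopological.Build (triple nu la)
  zariski_open zariski_openT zariski_openI zariski_open_bigU.

End Zariski.

Section OrbitSpace.
Variables nu la : dimvec Q.

Definition gact (c : graded_subspace nu) (z : triple nu la) : triple nu la :=
  Triple (fun i j h => invmx (c i) *m tx z h *m c j)
         (fun i => invmx (c i) *m tf z i)
         (fun i => tg z i *m c i).

Definition same_orbit (z z' : triple nu la) : bool :=
  `[< exists c : graded_subspace nu,
        (forall i, c i \in unitmx) /\ z' = gact c z >].

Lemma triple_ext (z z' : triple nu la) :
  (forall i j (h : hom i j), tx z h = tx z' h) ->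
  (forall i, tf z i = tf z' i) -> (forall i, tg z i = tg z' i) -> z = z'.
Proof.
case: z z' => [x f g] [x' f' g'] /= ex ef eg; congr Triple.
- by do 3![apply: functional_extensionality_dep => ?]; exact: ex.
- by apply: functional_extensionality_dep.
- by apply: functional_extensionality_dep.
Qed.

Lemma same_orbit_refl : reflexive same_orbit.
Proof.
move=> z; apply/asboolP; exists (fun=> 1%:M); split=> [i|].
  exact: unitmx1.
by apply: triple_ext => *; rewrite /= ?invmx1 ?mul1mx ?mulmx1.
Qed.

Lemma same_orbit_trans : transitive same_orbit.
Proof.
move=> _ z _ /asboolP[c [uc ->]] /asboolP[c' [uc' ->]]; apply/asboolP.
have invM i : invmx (c i *m c' i) = invmx (c' i) *m invmx (c i).
  have uM : c i *m c' i \in unitmx by rewrite unitmx_mul uc uc'.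
  by rewrite -[LHS](mulmxK (uc i)) -[_ *m c i](mulmxK (uc' i)) -(mulmxA _ (c i))
    mulVmx// mul1mx.
exists (fun i => c i *m c' i); split=> [i|].
  by rewrite unitmx_mul uc uc'.
by apply: triple_ext => *; rewrite /= ?invM ?mulmxA.
Qed.

Lemma same_orbit_sym z z' : same_orbit z z' = same_orbit z' z.
Proof.
suff H y y' : same_orbit y y' -> same_orbit y' y by apply/idP/idP; exact: H.
move=> /asboolP[c [uc ->]]; apply/asboolP; exists (fun i => invmx (c i)).
split=> [i|]; first by rewrite unitmx_inv.
apply: triple_ext => * /=; rewrite ?invmxK ?mulmxA ?mulmxV ?mul1mx//.
- by rewrite mulmxK.
- by rewrite mulmxK.
Qed.

Canonical same_orbit_equiv :=
  EquivRel same_orbit same_orbit_refl same_orbit_sym same_orbit_trans.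

(* The orbit space E_{nu,la} / G_nu with the quotient of the Zariski topology.
   The projection is open, hence for every G_nu-stable S the topology induced
   on the image of S is the quotient topology of S / G_nu; for the stable locus
   this is the Zariski topology of the geometric quotient. *)
Definition orbit_space := quotient_topology {eq_quot same_orbit_equiv}%qT.

Definition orb (z : triple nu la) : orbit_space := (\pi_orbit_space z)%qT.

End OrbitSpace.

Definition xstable nu (x : drep nu) (U : graded_subspace nu) :=
  forall i j (h : hom i j), (U i *m x i j h <= U j)%MS.

Definition moment_map nu la (z : triple nu la) (i : vertex Q) : 'M[K]_(nu i) :=
  tf z i *m tg z i +
  \sum_(j : vertex Q) \sum_(h : hom i j) eps K h *: (tx z h *m tx z (bar_hom h)).

Definition M_circ nu la : set (triple nu la) :=
  [set z | forall i, moment_map z i = 0].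

Definition stable nu la (z : triple nu la) :=
  forall U : graded_subspace nu, xstable (tx z) U ->
    (forall i, (U i <= kermx (tf z i))%MS) -> forall i, U i = 0.

Definition M_stable nu la : set (triple nu la) := @M_circ nu la `&` @stable nu la.

Definition seminilpotent nu (x : drep nu) :=
  exists (r : nat) (F : nat -> graded_subspace nu),
    [/\ forall i, (F 0%N i :=: 1%:M)%MS,
        forall i, F r i = 0,
        forall k, (k < r)%N ->
          (forall i, (F k.+1 i <= F k i)%MS) /\
          exists i, forall j, j != i -> (F k.+1 j :=: F k j)%MS
      & forall k, (k < r)%N -> forall i j (h : hom i j),
          (F k i *m x i j h <= F (if in_Omega (val h) then k.+1 else k) j)%MS].

Definition L_semi nu la : set (triple nu la) :=
  [set z | [/\ M_stable z, forall i, tg z i = 0 & seminilpotent (tx z)]].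

Definition L_frak nu la : set (orbit_space nu la) :=
  [set orb z | z in @L_semi nu la].

(* The framing space of dimension dadd la la' is W + W', in block form: W is
   spanned by the first la i coordinates and W' by the last la' i ones. Thus
   rsubmx (tf z i) is f_i followed by the projection to (W + W') / W = W', and
   usubmx (tg z i) is the restriction of g_i to W. *)
Section Tensor.
Variables la la' : dimvec Q.

Definition admissible v (z : triple v (dadd la la')) (V : graded_subspace v) :=
  [/\ xstable (tx z) V,
      forall i, V i *m rsubmx (tf z i : 'M_(v i, la i + la' i)) = 0
    & forall i, (tg z i <= V i)%MS].

Definition Z_circ v : set (triple v (dadd la la')) :=
  [set z | [/\ M_circ z,
      forall i, usubmx (tg z i : 'M_(la i + la' i, v i)) = 0
    & exists V, admissible z V]].

(* V = V(x,f,g) *)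
Definition is_Vmax v (z : triple v (dadd la la')) (V : graded_subspace v) :=
  admissible z V /\
  forall U, admissible z U -> forall i, (U i <= V i)%MS.

(* (z1, z2) are the triples (with g = 0) induced by z on V and on V_v / V,
   through isomorphisms of V with the standard space of dimension nu (given by
   its inverse iota, an embedding with image V) and of V_v / V with the one of
   dimension nu' (given by a surjection p with kernel V). *)
Definition induced_on v nu nu' (z : triple v (dadd la la'))
    (V : graded_subspace v) (z1 : triple nu la) (z2 : triple nu' la') :=
  exists (iota : forall i, 'M[K]_(nu i, v i)) (p : forall i, 'M[K]_(v i, nu' i)),
    [/\ forall i, row_free (iota i) /\ (iota i :=: V i)%MS,
        forall i, row_full (p i) /\ (kermx (p i) :=: V i)%MS,
        [/\ forall i j (h : hom i j), iota i *m tx z h = tx z1 h *m iota j,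
            forall i, iota i *m tf z i = row_mx (tf z1 i) 0
          & forall i, tg z1 i = 0]
      & [/\ forall i j (h : hom i j), tx z h *m p j = p i *m tx z2 h,
            forall i, rsubmx (tf z i : 'M_(v i, la i + la' i)) = p i *m tf z2 i
          & forall i, tg z2 i = 0]].

Definition Ztilde_circ v : set (triple v (dadd la la')) :=
  [set z | Z_circ z /\
    exists V, is_Vmax z V /\
    exists nu nu' (z1 : triple nu la) (z2 : triple nu' la'),
      [/\ induced_on z V z1 z2, seminilpotent (tx z1) & seminilpotent (tx z2)]].

Variables nu nu' : dimvec Q.

Definition Ztilde_circ_dim : set (triple (dadd nu nu') (dadd la la')) :=
  [set z | Ztilde_circ z /\
    exists V, is_Vmax z V /\ forall i, \rank (V i) = nu i].

Definition Ztilde : set (triple (dadd nu nu') (dadd la la')) :=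
  Ztilde_circ_dim `&` @stable _ _.

Definition Ztilde_frak : set (orbit_space (dadd nu nu') (dadd la la')) :=
  [set orb z | z in Ztilde].

Definition induced (z : triple (dadd nu nu') (dadd la la'))
    (z1 : triple nu la) (z2 : triple nu' la') :=
  exists V, is_Vmax z V /\ induced_on z V z1 z2.

(* T sends the class of (x,f,g) to the pair of classes of the induced maps; its
   values outside Ztilde_frak are irrelevant. *)
Definition is_induced_map (T : orbit_space (dadd nu nu') (dadd la la') ->
    orbit_space nu la * orbit_space nu' la') :=
  forall z, Ztilde z ->
    (exists z1 z2, induced z z1 z2) /\
    forall z1 z2, induced z z1 z2 ->
      [/\ L_semi z1, L_semi z2 & T (orb z) = (orb z1, orb z2)].

End Tensor.

End Representations.

(* Main.v *)
Require Import Defs.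
From HB Require Import structures.
From mathcomp Require Import all_boot all_order all_algebra.
From mathcomp Require Import all_classical reals topology_structure quotient_topology.
From mathcomp Require Import complex mpoly.

(** In a basis of the representation space adapted to V = V(x,f,g), a triple of
    [Ztilde] is block triangular: x has diagonal blocks x1, x2 and a free block
    y below them, f has blocks f1, f2 and u, and g has a single block g'. The
    diagonal blocks are the induced triples z1 and z2. They are stable of moment
    zero, the stability of z2 being the maximality of V. Conversely, block
    triangular triples of moment zero with z1 and z2 in the two Lagrangians lie
    in [Ztilde] and induce z1 and z2 ([extension_Ztilde]).

    Once z1 and z2 have moment zero, the moment map of the block triangular
    triple vanishes as soon as its off-diagonal block
      f2 g' + sum_h eps(h) (y_h x1_(bar h) + x2_h y_(bar h))
    does. This block is linear in (y, u, g'), and onto: a linear form c vanishing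
    on its image is an intertwiner from x1 to x2 with image in ker f2, and such
    an image is zero because z2 is stable ([off_moment_pairing], [system_full]).
    So the solutions form a vector space whose dimension does not depend on
    (z1, z2), and Cramer's rule carries a given solution to a family of solutions
    depending polynomially on (z1, z2): up to the group action, [Ztilde] is a
    vector bundle over the product of the two Lagrangians.

    Two facts follow. The preimage of a product C1 x C2 of irreducible sets is
    irreducible. Indeed a set fibred in irreducible sets over an irreducible base
    is irreducible when, for each closed A, the points whose fibre lies in A form
    a closed set ([irreducible_fibration]). This applies to the orbits over the
    orbit space, because any two elements of the group are joined by a line that
    meets the group in a cofinite set, and to the solution spaces over
    (z1, z2), because of the polynomial sections ([irreducible_blocks]). Secondly,
    the two components of the map are continuous on [Ztilde_frak]: V is the
    common kernel of covectors depending polynomially on the triple, hence near a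
    given triple a basis adapted to V can be chosen to depend polynomially on the
    triple ([local_triangularization]), and then z1 and z2 are rational functions
    of it.

    The rest is topology ([fibred_components_bij]): given a surjection onto a
    product with continuous components under which preimages of products of
    irreducible sets are irreducible, taking preimages is a bijection on
    irreducible components. *)

Set Implicit Arguments.
Unset Strict Implicit.
Unset Printing Implicit Defensive.

Import Order.TTheory GRing.Theory Num.Theory.
Local Open Scope classical_set_scope.
Local Open Scope ring_scope.
Local Notation hom := Defs.hom.

(** * Irreducible sets *)

Section Irreducible.
Variables S T : topologicalType.

(** Continuity is only asked relatively to Y, since the map of interest is
    continuous on a subset of the orbit space only. *)
Lemma irreducible_image (Y : set S) (f : S -> T) :
  (forall A, closed A -> exists2 A', closed A' & forall y, Y y -> A' y <-> A (f y)) ->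
  irreducible Y -> irreducible (f @` Y).
Proof.
move=> fc [[y0 Yy0] irrY]; split; first by exists (f y0), y0.
move=> A B cA cB sAB; have [A' cA' A'E] := fc _ cA; have [B' cB' B'E] := fc _ cB.
have [y Yy|sA|sB] := irrY _ _ cA' cB'.
- by have [] := sAB (f y) (imageP _ Yy); [left; apply/A'E|right; apply/B'E].
- by left=> _ [y Yy <-]; apply/A'E => //; apply: sA.
- by right=> _ [y Yy <-]; apply/B'E => //; apply: sB.
Qed.

Lemma irreducible_image_continuous (Y : set S) (f : S -> T) :
  (forall A, closed A -> closed (f @^-1` A)) ->
  irreducible Y -> irreducible (f @` Y).
Proof. by move=> fc; apply: irreducible_image => A /fc; exists (f @^-1` A). Qed.

(** A cover of the union by A and B makes each fibre lie in A or in B; the two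
    sets of base points so obtained are closed in C and cover it, so one of
    them contains C. *)
Lemma irreducible_fibration (C : set S) (F : S -> set T) :
  irreducible C -> (forall x, C x -> irreducible (F x)) ->
  (forall A, closed A ->
     exists2 A', closed A' & forall x, C x -> A' x <-> F x `<=` A) ->
  irreducible (\bigcup_(x in C) F x).
Proof.
move=> [[x0 Cx0] irrC] irrF Fc; split.
  by have [[y Fy] _] := irrF _ Cx0; exists y, x0.
move=> A B cA cB sAB; have [A' cA' A'E] := Fc _ cA; have [B' cB' B'E] := Fc _ cB.
have [x Cx|sA|sB] := irrC _ _ cA' cB'.
- have [_ irrFx] := irrF _ Cx.
  have [y Fy|sA|sB] := irrFx _ _ cA cB; first by apply: sAB; exists x.
  + by left; apply/(A'E _ Cx).
  + by right; apply/(B'E _ Cx).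
- by left=> y [x Cx]; apply: (A'E _ Cx).1; apply: sA.
- by right=> y [x Cx]; apply: (B'E _ Cx).1; apply: sB.
Qed.

End Irreducible.

Section Components.
Variable T : topologicalType.

(** Zorn's lemma: the union of a chain of irreducible sets is irreducible,
    since sets of the chain escaping A and B have a common upper bound in the
    chain. *)
Lemma irreducible_in_component (Y X : set T) :
  irreducible X -> X `<=` Y -> exists2 C, Irr Y C & X `<=` C.
Proof.
move=> irrX sXY.
(* The union with X makes the empty chain harmless. *)
pose P (Z : set T) := Z `<=` Y /\ irreducible (X `|` Z).
have [F sFP totF|Z [[sZY irrXZ] maxZ]] := @Zorn_bigcup T P.
  split; first by move=> y [Z /sFP[sZY _]]; apply: sZY.
  have [F0|/set0P[Z0 FZ0]] := eqVneq F set0.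
    by rewrite F0 bigcup_set0 setU0.
  split; first by have [[x Xx] _] := irrX; exists x; left.
  have escape (D : set T) : ~ (X `|` \bigcup_(Z in F) Z `<=` D) ->
      exists2 Z, F Z & ~ (X `|` Z `<=` D).
    move=> /nonsubset[x [[Xx|[Z FZ Zx]] nDx]].
      by exists Z0 => // /(_ x (or_introl Xx)).
    by exists Z => // /(_ x (or_intror Zx)).
  move=> A B cA cB sAB; apply: contrapT => /not_orP[].
  move=> /escape[Z1 FZ1 nA1] /escape[Z2 FZ2 nB2].
  have [Z [FZ nA nB]] : exists Z, [/\ F Z, ~ (X `|` Z `<=` A)
                                     & ~ (X `|` Z `<=` B)].
    have [s12|s21] := totF _ _ FZ1 FZ2.
      by exists Z2; split=> // sA; apply: nA1; apply: subset_trans sA; apply: setUS.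
    by exists Z1; split=> // sB; apply: nB2; apply: subset_trans sB; apply: setUS.
  have [_ [_ irrXZ]] := sFP _ FZ.
  have [|//|//] := irrXZ _ _ cA cB.
  by apply: subset_trans sAB; apply: setUS => x Zx; exists Z.
exists (X `|` Z); last by move=> x; left.
split=> //; first by rewrite subUset.
move=> X' sX'Y irrX' sXX'; apply: contrapT => neq; apply: (maxZ X').
  split; first by apply: subset_trans sXX' => x; right.
  move=> sX'Z; apply: neq; apply/seteqP; split=> //.
  by apply: subset_trans sX'Z _ => x; right.
split=> //; rewrite setUidr //.
by apply: subset_trans sXX' => x; left.
Qed.

End Components.

Section FibredComponents.
Variables (S S1 S2 : topologicalType).
Variables (Z : set S) (Y1 : set S1) (Y2 : set S2) (T : S -> S1 * S2).

Definition closed_preimages (T : topologicalType) (f : S -> T) :=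
  forall A, closed A -> exists2 A', closed A' & forall z, Z z -> A' z <-> A (f z).

Hypothesis TZ : forall z, Z z -> Y1 (T z).1 /\ Y2 (T z).2.
Hypothesis surjT : forall y1 y2, Y1 y1 -> Y2 y2 -> exists2 z, Z z & T z = (y1, y2).
Hypothesis cont1 : closed_preimages (fun z => (T z).1).
Hypothesis cont2 : closed_preimages (fun z => (T z).2).
Hypothesis irrT : forall C1 C2, C1 `<=` Y1 -> C2 `<=` Y2 ->
  irreducible C1 -> irreducible C2 ->
  irreducible (Z `&` T @^-1` (C1 `*` C2)).

Lemma irreducible_projection (S' : topologicalType) (f : S -> S') X :
  closed_preimages f -> X `<=` Z -> irreducible X -> irreducible (f @` X).
Proof.
move=> cf sXZ; apply: irreducible_image => A /cf[A' cA' A'E].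
by exists A' => // z /sXZ; apply: A'E.
Qed.

(** A product C1 x C2 is recovered from its preimage by surjectivity. If an
    irreducible set contains that preimage, then its projections are
    irreducible and contain C1 and C2, hence equal them when these are
    components. Every component of Z projects into some C1 and C2, and then
    fills the preimage of their product. *)
Lemma fibred_components_bij :
  set_bij (Irr Y1 `*` Irr Y2) (Irr Z) (fun X => Z `&` T @^-1` (X.1 `*` X.2)).
Proof.
have recover C1 C2 X : irreducible C1 -> irreducible C2 ->
    C1 `<=` Y1 -> C2 `<=` Y2 -> Z `&` T @^-1` (C1 `*` C2) `<=` X ->
    C1 `<=` (fun z => (T z).1) @` X /\ C2 `<=` (fun z => (T z).2) @` X.
  move=> [[c1 Cc1] _] [[c2 Cc2] _] sC1 sC2 sX; split=> c Cc.
    have [z Zz Tz] := surjT (sC1 _ Cc) (sC2 _ Cc2).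
    by exists z; rewrite ?Tz //; apply: sX; split=> //=; rewrite Tz.
  have [z Zz Tz] := surjT (sC1 _ Cc1) (sC2 _ Cc).
  by exists z; rewrite ?Tz //; apply: sX; split=> //=; rewrite Tz.
split.
- move=> [C1 C2] /= [[/= sC1 irrC1 maxC1] [sC2 irrC2 maxC2]].
  split; [by move=> z []|exact: irrT|].
  move=> X sXZ irrX sX; have [sC1X sC2X] := recover _ _ _ irrC1 irrC2 sC1 sC2 sX.
  have X1 := maxC1 _ _ (irreducible_projection cont1 sXZ irrX) sC1X.
  have X2 := maxC2 _ _ (irreducible_projection cont2 sXZ irrX) sC2X.
  apply/seteqP; split=> // z Xz; split; first exact: sXZ.
  split=> /=; [rewrite -X1|rewrite -X2]; try by exists z.
    by move=> _ [z' /sXZ/TZ[? _] <-].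
  by move=> _ [z' /sXZ/TZ[_ ?] <-].
- move=> [C1 C2] [D1 D2]; rewrite !inE /=.
  move=> [[/= sC1 irrC1 maxC1] [sC2 irrC2 maxC2]].
  move=> [[/= sD1 irrD1 maxD1] [sD2 irrD2 maxD2]] CD.
  have inj1 : C1 `<=` D1 /\ C2 `<=` D2.
    have [s1 s2] := recover _ _ _ irrC1 irrC2 sC1 sC2 (@subset_refl _ _).
    by rewrite CD in s1 s2; split=> c; [move=> /s1|move=> /s2] => -[z [_ []]] ? ? <-.
  have inj2 : D1 `<=` C1 /\ D2 `<=` C2.
    have [s1 s2] := recover _ _ _ irrD1 irrD2 sD1 sD2 (@subset_refl _ _).
    by rewrite -CD in s1 s2; split=> c; [move=> /s1|move=> /s2] => -[z [_ []]] ? ? <-.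
  by congr pair; apply/seteqP; split; tauto.
- move=> X [sXZ irrX maxX].
  have irr1 := irreducible_projection cont1 sXZ irrX.
  have irr2 := irreducible_projection cont2 sXZ irrX.
  have [|C1 [sC1 irrC1 maxC1] sX1] := irreducible_in_component (Y := Y1) irr1.
    by move=> _ [z /sXZ/TZ[? _] <-].
  have [|C2 [sC2 irrC2 maxC2] sX2] := irreducible_in_component (Y := Y2) irr2.
    by move=> _ [z /sXZ/TZ[_ ?] <-].
  exists (C1, C2) => //=.
  apply: maxX; [by move=> z []|exact: irrT|] => z Xz.
  split; first exact: sXZ.
  by split=> /=; [apply: sX1|apply: sX2]; exists z.
Qed.

End FibredComponents.

(** * Rings of functions *)

Section FunctionRings.
Variables (K : fieldType) (T : Type).
Implicit Types (reg : set (T -> K)) (phi psi d : T -> K).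

(** Lines, affine spaces and their principal open subsets are treated at once
    by abstracting the ring of their regular functions. This makes it possible
    to say that a family of matrices or triples is regular, whatever its
    parameter space. *)
Definition function_ring reg :=
  [/\ forall a, reg (fun=> a),
      forall phi psi, reg phi -> reg psi -> reg (fun t => phi t + psi t)
    & forall phi psi, reg phi -> reg psi -> reg (fun t => phi t * psi t)].

(** The functions that are regular where d does not vanish; their values
    elsewhere are arbitrary. *)
Definition localization reg d : set (T -> K) := [set phi |
  exists N q, reg q /\ forall t, d t != 0 -> phi t * d t ^+ N = q t].

Section Closure.
Variable reg : set (T -> K).
Hypothesis regR : function_ring reg.

Lemma reg_const a : reg (fun=> a). Proof. by case: regR. Qed.

Lemma regD phi psi : reg phi -> reg psi -> reg (fun t => phi t + psi t).
Proof. by case: regR => _ + _; apply. Qed.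

Lemma regM phi psi : reg phi -> reg psi -> reg (fun t => phi t * psi t).
Proof. by case: regR => _ _; apply. Qed.

Lemma reg_sum (I : Type) (r : seq I) (P : pred I) (F : I -> T -> K) :
  (forall i, P i -> reg (F i)) -> reg (fun t => \sum_(i <- r | P i) F i t).
Proof.
move=> regF; elim: r => [|i r IHr].
  by rewrite (_ : (fun _ => _) = fun=> 0) ?funeqE => [|t]; [exact: reg_const|rewrite big_nil].
case Pi: (P i); last first.
  rewrite (_ : (fun _ => _) = fun t => \sum_(i <- r | P i) F i t) //.
  by apply/funext => t; rewrite big_cons Pi.
rewrite (_ : (fun _ => _) = fun t => F i t + \sum_(i <- r | P i) F i t).
  by apply: regD => //; apply: regF.
by apply/funext => t; rewrite big_cons Pi.
Qed.

Lemma reg_prod (I : Type) (r : seq I) (P : pred I) (F : I -> T -> K) :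
  (forall i, P i -> reg (F i)) -> reg (fun t => \prod_(i <- r | P i) F i t).
Proof.
move=> regF; elim: r => [|i r IHr].
  by rewrite (_ : (fun _ => _) = fun=> 1) ?funeqE => [|t]; [exact: reg_const|rewrite big_nil].
case Pi: (P i); last first.
  rewrite (_ : (fun _ => _) = fun t => \prod_(i <- r | P i) F i t) //.
  by apply/funext => t; rewrite big_cons Pi.
rewrite (_ : (fun _ => _) = fun t => F i t * \prod_(i <- r | P i) F i t).
  by apply: regM => //; apply: regF.
by apply/funext => t; rewrite big_cons Pi.
Qed.

Lemma regX phi n : reg phi -> reg (fun t => phi t ^+ n).
Proof.
move=> rphi; rewrite (_ : (fun _ => _) = fun t => \prod_(i < n) phi t).
  exact: reg_prod.
by apply/funext => t; rewrite prodr_const card_ord.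
Qed.

Lemma reg_meval n (p : {mpoly K[n]}) (v : T -> 'I_n -> K) :
  (forall k, reg (fun t => v t k)) -> reg (fun t => p.@[v t]).
Proof.
move=> regv; rewrite (_ : (fun _ => _) =
    fun t => \sum_(m <- msupp p) p@_m * \prod_i v t i ^+ m i).
  apply: reg_sum => m _; apply: regM; first exact: reg_const.
  by apply: reg_prod => i _; apply: regX.
by apply/funext => t; rewrite mevalE.
Qed.

Lemma localization_ring d : reg d -> function_ring (localization reg d).
Proof.
move=> regd; split=> [a|phi psi [N [p [rp Ep]]] [M [q [rq Eq]]]
                       |phi psi [N [p [rp Ep]]] [M [q [rq Eq]]]].
- exists 0%N, (fun=> a); split=> [|t _]; first exact: reg_const.
  by rewrite expr0 mulr1.
- exists (N + M)%N, (fun t => p t * d t ^+ M + q t * d t ^+ N); split=> [|t dt].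
    by apply: regD; apply: regM => //; apply: regX.
  by rewrite -Ep // -Eq // mulrDl -!mulrA -!exprD (addnC M).
- exists (N + M)%N, (fun t => p t * q t); split=> [|t dt]; first exact: regM.
  by rewrite -Ep // -Eq // mulrACA exprD.
Qed.

Lemma localization_incl d phi : reg phi -> localization reg d phi.
Proof. by move=> rphi; exists 0%N, phi; split=> // t _; rewrite expr0 mulr1. Qed.

End Closure.

Section Matrices.
Variable reg : set (T -> K).
Hypothesis regR : function_ring reg.

Definition reg_mx m n (A : T -> 'M[K]_(m, n)) :=
  forall i j, reg (fun t => A t i j).

Lemma reg_mxP m n (A : T -> 'M[K]_(m, n)) (F : T -> 'I_m -> 'I_n -> K) :
  (forall t i j, A t i j = F t i j) ->
  (forall i j, reg (fun t => F t i j)) -> reg_mx A.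
Proof.
move=> AF rF i j; rewrite (_ : (fun _ => _) = fun t => F t i j) //.
by apply/funext => t.
Qed.

Lemma reg_mx_const m n (A : 'M[K]_(m, n)) : reg_mx (fun=> A).
Proof. by move=> i j; apply: reg_const. Qed.

Lemma reg_mxD m n (A B : T -> 'M[K]_(m, n)) :
  reg_mx A -> reg_mx B -> reg_mx (fun t => A t + B t).
Proof.
move=> rA rB; apply: (reg_mxP (F := fun t i j => A t i j + B t i j)) => [t i j|i j].
  by rewrite mxE.
exact: regD.
Qed.

Lemma reg_mxZ m n phi (A : T -> 'M[K]_(m, n)) :
  reg phi -> reg_mx A -> reg_mx (fun t => phi t *: A t).
Proof.
move=> rphi rA; apply: (reg_mxP (F := fun t i j => phi t * A t i j)) => [t i j|i j].
  by rewrite mxE.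
exact: regM.
Qed.

Lemma reg_mxN m n (A : T -> 'M[K]_(m, n)) : reg_mx A -> reg_mx (fun t => - A t).
Proof.
move=> rA; apply: (reg_mxP (F := fun t i j => (-1) * A t i j)) => [t i j|i j].
  by rewrite mxE mulN1r.
by apply: regM => //; apply: reg_const.
Qed.

Lemma reg_mulmx m n p (A : T -> 'M[K]_(m, n)) (B : T -> 'M[K]_(n, p)) :
  reg_mx A -> reg_mx B -> reg_mx (fun t => A t *m B t).
Proof.
move=> rA rB.
apply: (reg_mxP (F := fun t i j => \sum_k A t i k * B t k j)) => [t i j|i j].
  by rewrite mxE.
by apply: reg_sum => // k _; apply: regM.
Qed.

Lemma reg_mx_sum m n (I : Type) (r : seq I) (P : pred I)
    (F : I -> T -> 'M[K]_(m, n)) :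
  (forall i, P i -> reg_mx (F i)) -> reg_mx (fun t => \sum_(i <- r | P i) F i t).
Proof.
move=> rF; apply: (reg_mxP
    (F := fun t a b => \sum_(i <- r | P i) F i t a b)) => [t a b|a b].
  by rewrite summxE.
by apply: reg_sum => // i Pi; apply: rF.
Qed.

Lemma reg_row_mx m n1 n2 (A : T -> 'M[K]_(m, n1)) (B : T -> 'M[K]_(m, n2)) :
  reg_mx A -> reg_mx B -> reg_mx (fun t => row_mx (A t) (B t)).
Proof.
move=> rA rB i j; case: (split_ordP j) => k ->.
  by under eq_fun do rewrite row_mxEl.
by under eq_fun do rewrite row_mxEr.
Qed.

Lemma reg_col_mx m1 m2 n (A : T -> 'M[K]_(m1, n)) (B : T -> 'M[K]_(m2, n)) :
  reg_mx A -> reg_mx B -> reg_mx (fun t => col_mx (A t) (B t)).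
Proof.
move=> rA rB i j; case: (split_ordP i) => k ->.
  by under eq_fun do rewrite col_mxEu.
by under eq_fun do rewrite col_mxEd.
Qed.

Lemma reg_block_mx m1 m2 n1 n2 (A : T -> 'M[K]_(m1, n1)) (B : T -> 'M[K]_(m1, n2))
    (C : T -> 'M[K]_(m2, n1)) (D : T -> 'M[K]_(m2, n2)) :
  reg_mx A -> reg_mx B -> reg_mx C -> reg_mx D ->
  reg_mx (fun t => block_mx (A t) (B t) (C t) (D t)).
Proof. by move=> *; apply: reg_col_mx; apply: reg_row_mx. Qed.

Lemma reg_det n (A : T -> 'M[K]_n) : reg_mx A -> reg (fun t => \det (A t)).
Proof.
move=> rA; rewrite /determinant; apply: reg_sum => // s _.
by apply: regM => //; [apply: reg_const|apply: reg_prod => // i _; apply: rA].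
Qed.

Lemma reg_adjugate n (A : T -> 'M[K]_n) : reg_mx A -> reg_mx (fun t => \adj (A t)).
Proof.
move=> rA; apply: (reg_mxP (F := fun t i j => cofactor (A t) j i)) => [t i j|i j].
  by rewrite mxE.
rewrite /cofactor; apply: regM => //; first exact: reg_const.
by apply: reg_det; rewrite /row' /col'; move=> a b; under eq_fun do rewrite !mxE; apply: rA.
Qed.

End Matrices.

(** The adjugate divided by the determinant. The denominator d is a common one
    for several matrices, so it is only a multiple of this determinant. *)
Lemma reg_invmx reg d e n (A : T -> 'M[K]_n) : function_ring reg ->
  reg_mx reg A -> reg e -> (forall t, d t = \det (A t) * e t) -> reg d ->
  reg_mx (localization reg d) (fun t => invmx (A t)).
Proof.
move=> regR rA re dE rd i j.
exists 1%N, (fun t => \adj (A t) i j * e t); split.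
  by apply: regM => //; apply: reg_adjugate.
move=> t; rewrite dE mulf_eq0 negb_or => /andP[dA0 _].
by rewrite /invmx unitmxE unitfE dA0 mxE expr1 mulrACA mulVf // mul1r.
Qed.


Section Triples.
Variables (Q : quiver) (nu la : dimvec Q).
Variable reg : set (T -> K).
Hypothesis regR : function_ring reg.

Definition reg_triple (z : T -> triple K nu la) :=
  [/\ forall i j (h : hom i j), reg_mx reg (fun t => tx (z t) h),
      forall i, reg_mx reg (fun t => tf (z t) i)
    & forall i, reg_mx reg (fun t => tg (z t) i)].

Lemma reg_tripleP z : reg_triple z <-> forall k, reg (fun t => entries (z t) k).
Proof.
split=> [[rx rf rg] k|rz].
  rewrite /entries; case: (enum_val k) => [[[i j] [h [a b]]]|[[i [a b]]|[i [a b]]]] /=.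
  - exact: rx.
  - exact: rf.
  - exact: rg.
have rz' c : reg (fun t => entry (z t) c).
  by rewrite -(enum_rankK c); apply: rz.
split=> [i j h a b|i a b|i a b].
- exact: (rz' (inl (existT (fun ij => (hom ij.1 ij.2 * ('I_(nu ij.1) * 'I_(nu ij.2)))%type)
    (i, j) (h, (a, b))))).
- exact: (rz' (inr (inl (existT (fun i => ('I_(nu i) * 'I_(la i))%type) i (a, b))))).
- exact: (rz' (inr (inr (existT (fun i => ('I_(la i) * 'I_(nu i))%type) i (a, b))))).
Qed.

Lemma reg_triple_meval z (p : {mpoly K[#|entry_index nu la|]}) :
  reg_triple z -> reg (fun t => p.@[entries (z t)]).
Proof. by move=> /reg_tripleP rz; apply: reg_meval. Qed.

End Triples.

Lemma reg_triple_localization (Q : quiver) (nu la : dimvec Q) reg d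
    (z : T -> triple K nu la) :
  function_ring reg -> reg_triple reg z -> reg_triple (localization reg d) z.
Proof.
by move=> regR [rx rf rg]; split=> *; move=> a b; apply: localization_incl => //;
  [apply: rx|apply: rf|apply: rg].
Qed.

(** The product of the determinants is a common denominator for the inverses
    occurring in the action. *)
Lemma reg_gact (Q : quiver) (nu la : dimvec Q) reg
    (c : T -> graded_subspace K nu) (z : T -> triple K nu la) :
  function_ring reg -> (forall i, reg_mx reg (fun t => c t i)) ->
  reg_triple reg z ->
  reg (fun t => \prod_i \det (c t i)) /\
  reg_triple (localization reg (fun t => \prod_i \det (c t i)))
             (fun t => gact (c t) (z t)).
Proof.
move=> regR rc rz; set d := fun t => _.
have rd : reg d by apply: reg_prod => // i _; apply: reg_det.
have [rx rf rg] := reg_triple_localization d regR rz.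
have locR : function_ring (localization reg d) by apply: localization_ring.
have rc' i : reg_mx (localization reg d) (fun t => c t i).
  by move=> a b; apply: localization_incl => //; apply: rc.
have rVc i : reg_mx (localization reg d) (fun t => invmx (c t i)).
  apply: (reg_invmx (e := fun t => \prod_(j | j != i) \det (c t j))) => //.
    by apply: reg_prod => // j _; apply: reg_det.
  by move=> t; rewrite /d (bigD1 i).
by split=> //; split=> *; rewrite /gact /=; do ?apply: reg_mulmx.
Qed.

End FunctionRings.

(** * Curves and morphisms *)

Section Line.
Variable K : numFieldType.

Definition line_functions : set (K -> K) :=
  [set phi | exists p : {poly K}, forall t, phi t = p.[t]].

Lemma line_functions_ring : function_ring line_functions.
Proof.
split=> [a|phi psi [p Ep] [q Eq]|phi psi [p Ep] [q Eq]].
- by exists a%:P => t; rewrite hornerC.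
- by exists (p + q) => t; rewrite hornerD Ep Eq.
- by exists (p * q) => t; rewrite hornerM Ep Eq.
Qed.

(** The integers 0, 1, 2, ... are distinct in K, so a nonzero polynomial
    cannot vanish at all of them. *)
Lemma nonroot (p : {poly K}) : p != 0 -> exists t, p.[t] != 0.
Proof.
move=> p0; apply: contrapT => /forallNP all0.
pose s := [seq (n%:R : K) | n <- iota 0 (size p)].
have us : uniq s by rewrite map_inj_uniq ?iota_uniq // => m n /eqP; rewrite eqr_nat => /eqP.
have rs : all (root p) s.
  by apply/allP => t _; apply/negP => /negP; apply: all0.
by have := max_poly_roots p0 rs us; rewrite size_map size_iota ltnn.
Qed.

Lemma line_common_nonzero (phi psi chi : K -> K) (a b c : K) :
  line_functions phi -> line_functions psi -> line_functions chi ->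
  phi a != 0 -> psi b != 0 -> chi c != 0 ->
  exists t, [/\ phi t != 0, psi t != 0 & chi t != 0].
Proof.
move=> [p Ep] [q Eq] [r Er]; rewrite Ep Eq Er => pa qb rc.
have nz (s : {poly K}) x : s.[x] != 0 -> s != 0.
  by apply: contraNneq => ->; rewrite horner0.
have [|t] := @nonroot (p * q * r).
  by rewrite !mulf_neq0 //; [apply: nz pa|apply: nz qb|apply: nz rc].
rewrite !hornerM !mulf_eq0 !negb_or => /andP[/andP[? ?] ?].
by exists t; rewrite Ep Eq Er.
Qed.

End Line.

Section ZariskiTopology.
Variables (K : numFieldType) (Q : quiver) (nu la : dimvec Q).
Local Notation E := (triple K nu la).

Lemma zariski_closedP (A : set E) :
  closed A <-> exists S, A = zero_locus S.
Proof.
rewrite -openC; split=> -[S].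
  by rewrite setCK => AS; exists S.
by move=> AS; exists S; rewrite setCK.
Qed.

Lemma closed_separation (A : set E) z : closed A -> ~ A z ->
  exists p : {mpoly K[#|entry_index nu la|]},
    (forall z', A z' -> p.@[entries z'] = 0) /\ p.@[entries z] != 0.
Proof.
move=> /zariski_closedP[S ->] /existsNP[p /not_implyP[Sp /eqP pz]].
by exists p; split=> // z' Az'; apply: Az'.
Qed.

Definition regular_functions : set (E -> K) :=
  [set phi | exists p : {mpoly K[#|entry_index nu la|]},
     forall z, phi z = p.@[entries z]].

Lemma regular_functions_ring : function_ring regular_functions.
Proof.
split=> [a|phi psi [p Ep] [q Eq]|phi psi [p Ep] [q Eq]].
- by exists a%:MP => z; rewrite mevalC.
- by exists (p + q) => z; rewrite mevalD Ep Eq.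
- by exists (p * q) => z; rewrite mevalM Ep Eq.
Qed.

Lemma reg_triple_id : reg_triple regular_functions id.
Proof.
by apply/reg_tripleP => k; exists 'X_k => z; rewrite mevalXU.
Qed.

Lemma closed_regular_zeros phi : regular_functions phi -> closed [set z | phi z = 0].
Proof.
move=> [p Ep]; apply/zariski_closedP; exists [set p]; apply/seteqP; split=> z /=.
  by rewrite Ep => pz q ->.
by rewrite Ep; apply.
Qed.

(** Polynomials separating z0 from A and z1 from B become, along a rational
    curve from z0 to z1, nonzero rational functions of one variable; at a
    common nonzero value of the two, the curve is outside A and B. *)
Lemma irreducible_by_curves (Y : set E) : Y !=set0 ->
  (forall z0 z1, Y z0 -> Y z1 -> exists (z : K -> E) (d : K -> K),
     [/\ line_functions d, reg_triple (localization (@line_functions K) d) z,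
         z 0 = z0 /\ z 1 = z1, d 0 != 0 /\ d 1 != 0 & forall t, d t != 0 -> Y (z t)]) ->
  irreducible Y.
Proof.
move=> Y0 curves; split=> // A B cA cB sAB; apply: contrapT => /not_orP[].
move=> /nonsubset[z0 [Yz0 nA]] /nonsubset[z1 [Yz1 nB]].
have [z [d [ld rz [zE0 zE1] [d0 d1] Yz]]] := curves _ _ Yz0 Yz1.
have [p [pA pz0]] := closed_separation cA nA.
have [q [qB qz1]] := closed_separation cB nB.
have lR := localization_ring (@line_functions_ring K) ld.
have [N [p' [lp' Ep]]] := reg_triple_meval lR p rz.
have [M [q' [lq' Eq]]] := reg_triple_meval lR q rz.
have [|||t [dt pt qt]] := line_common_nonzero (a := 0) (b := 0) (c := 1) ld lp' lq'.
- by [].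
- by rewrite -Ep // zE0 mulf_neq0 // expf_neq0.
- by rewrite -Eq // zE1 mulf_neq0 // expf_neq0.
have [/pA pz|/qB qz] := sAB _ (Yz _ dt).
  by move: pt; rewrite -Ep // pz mul0r eqxx.
by move: qt; rewrite -Eq // qz mul0r eqxx.
Qed.

End ZariskiTopology.

Lemma closed_preimage (K : numFieldType) (Q : quiver)
    (nu la nu' la' : dimvec Q) (s : triple K nu la -> triple K nu' la') A :
  reg_triple (@regular_functions K Q nu la) s -> closed A -> closed (s @^-1` A).
Proof.
move=> rs /zariski_closedP[S ->].
have -> : s @^-1` zero_locus S = \bigcap_(p in S) [set z | p.@[entries (s z)] = 0].
  by apply/seteqP; split=> z Sz p Sp; apply: Sz.
apply: closed_bigI => p _; apply: closed_regular_zeros.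
by have := reg_triple_meval (@regular_functions_ring K Q nu la) p rs.
Qed.

(** * Orbits *)

Section Orbits.
Variables (K : fieldType) (Q : quiver) (nu la : dimvec Q).
Local Notation E := (triple K nu la).
Implicit Types (z : E) (c : graded_subspace K nu).

Definition invertible c := forall i, c i \in unitmx.

Lemma orb_eqP z z' : orb z = orb z' <-> exists2 c, invertible c & z' = gact c z.
Proof.
split=> [/eqquotP/asboolP[c [uc ->]]|[c uc z'E]]; first by exists c.
by apply/eqquotP/asboolP; exists c.
Qed.

Lemma orb_gact c z : invertible c -> orb (gact c z) = orb z.
Proof. by move=> uc; apply/esym/orb_eqP; exists c. Qed.

Lemma orbW (o : orbit_space K nu la) : exists z, orb z = o.
Proof. by exists (repr o); rewrite /orb reprK. Qed.

Lemma invertible_inv c : invertible c -> invertible (fun i => invmx (c i)).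
Proof. by move=> uc i; rewrite unitmx_inv. Qed.

End Orbits.

Section OrbitTopology.
Variables (K : numFieldType) (Q : quiver) (nu la : dimvec Q).
Local Notation E := (triple K nu la).
Implicit Types (z : E) (c : graded_subspace K nu).

Lemma closed_orbP (A : set (orbit_space K nu la)) :
  closed A <-> closed (@orb K Q nu la @^-1` A).
Proof. by rewrite -!openC. Qed.

Lemma reg_triple_gact c : reg_triple (@regular_functions K Q nu la) (gact c).
Proof.
have [rx rf rg] := @reg_triple_id K Q nu la.
have regR := @regular_functions_ring K Q nu la.
by split=> *; rewrite /gact /=; do ?apply: reg_mulmx => //;
  try exact: reg_mx_const; auto.
Qed.

(** The preimage in the triple space is the intersection of the translates of
    A by the group. *)
Lemma closed_full_orbits (A : set E) : closed A ->
  closed [set o | forall z, orb z = o -> A z].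
Proof.
move=> cA; apply/closed_orbP.
have -> : @orb K Q nu la @^-1` [set o | forall z, orb z = o -> A z] =
    \bigcap_(c in @invertible K Q nu) (gact c @^-1` A).
  apply/seteqP; split=> z /= Az.
    by move=> c uc; apply: Az; rewrite orb_gact.
  by move=> z' /esym/orb_eqP[c uc ->]; apply: Az.
by apply: closed_bigI => c _; apply: closed_preimage => //; apply: reg_triple_gact.
Qed.

Lemma line_affine (a b : K) : line_functions (fun t => (1 - t) * a + t * b).
Proof.
by exists ((1 - 'X) * a%:P + 'X * b%:P) => t; rewrite !hornerE.
Qed.

(** The line through two elements of the group meets the group in the
    complement of the zeros of a determinant, which turns it into a rational
    curve in the orbit. *)
Lemma irreducible_orbit z : irreducible [set z' | orb z' = orb z].
Proof.
apply: irreducible_by_curves; first by exists z.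
move=> _ _ /= /esym/orb_eqP[c0 u0 ->] /esym/orb_eqP[c1 u1 ->].
pose c (t : K) : graded_subspace K nu := fun i => (1 - t) *: c0 i + t *: c1 i.
have lc i : reg_mx (@line_functions K) (fun t => c t i).
  move=> a b; under eq_fun do rewrite !mxE; exact: line_affine.
have lz : reg_triple (@line_functions K) (fun=> z).
  by split=> *; apply: reg_mx_const; apply: line_functions_ring.
have [ld rz] := reg_gact (@line_functions_ring K) lc lz.
have cE0 : c 0 = c0.
  by apply: functional_extensionality_dep => i; rewrite /c subr0 scale1r scale0r addr0.
have cE1 : c 1 = c1.
  by apply: functional_extensionality_dep => i; rewrite /c subrr scale1r scale0r add0r.
exists (fun t => gact (c t) z), (fun t => \prod_i \det (c t i)); split=> //.
- by rewrite cE0 cE1.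
- by rewrite cE0 cE1; split; apply/prodf_neq0 => i _;
    rewrite -unitfE -unitmxE; [apply: u0|apply: u1].
- move=> t dt; rewrite orb_gact // => i; rewrite unitmxE unitfE.
  by move/prodf_neq0: dt; apply.
Qed.

Lemma irreducible_orb_preimage (C : set (orbit_space K nu la)) :
  irreducible C -> irreducible (@orb K Q nu la @^-1` C).
Proof.
move=> irrC.
have -> : @orb K Q nu la @^-1` C = \bigcup_(o in C) [set z | orb z = o].
  by apply/seteqP; split=> [z Cz|z [o /[swap] <-]] //; exists (orb z).
apply: irreducible_fibration => //.
  by move=> o _; have [z <-] := orbW o; apply: irreducible_orbit.
by move=> A cA; exists [set o | forall z, orb z = o -> A z] => //;
  apply: closed_full_orbits.
Qed.

Lemma irreducible_orb_image (Y : set E) : irreducible Y ->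
  irreducible [set orb z | z in Y].
Proof.
apply: irreducible_image_continuous => A; exact: (closed_orbP A).1.
Qed.

(** B is invariant under the group; the points whose whole orbit lies in the
    closure of B then trace B on Z. *)
Lemma relatively_closed_orbits (Z B : set E) :
  (forall z z', orb z = orb z' -> B z -> B z') ->
  (forall z, Z z -> ~ B z -> exists D, [/\ closed D, B `<=` D & ~ D z]) ->
  exists2 A', closed A' & forall z, Z z -> A' (orb z) <-> B z.
Proof.
move=> Bstable sepB.
exists [set o | forall z, orb z = o -> closure B z].
  by apply: closed_full_orbits; apply: closed_closure.
move=> z Zz; split=> [Bz|Bz z' zz'].
  apply: contrapT => nBz; have [D [cD sBD]] := sepB z Zz nBz; apply.
  by apply: cD; apply: (closureS sBD); apply: Bz.
by apply: subset_closure; apply: Bstable Bz.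
Qed.

End OrbitTopology.

(** * Extensions of framed representations *)

Section Extensions.
Variables (K : fieldType) (Q : quiver) (la la' v nu nu' : dimvec Q).
Implicit Types (z : triple K v (dadd la la')).

Definition quot_tf v (z : triple K v (dadd la la')) i : 'M[K]_(v i, la' i) :=
  rsubmx (tf z i : 'M_(v i, la i + la' i)).

(** A presentation of z as an extension of z2 by z1. Unlike [induced_on], it
    names no subspace: the image of iota plays the role of V, and the
    conditions on g say that V contains the image of g and that g kills W. *)
Record extension_maps z (z1 : triple K nu la) (z2 : triple K nu' la')
    (iota : forall i, 'M[K]_(nu i, v i))
    (p : forall i, 'M[K]_(v i, nu' i)) : Prop := ExtensionMaps {
  ext_free : forall i, row_free (iota i);
  ext_full : forall i, row_full (p i);
  ext_exact : forall i, (kermx (p i) :=: iota i)%MS;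
  ext_x1 : forall i j (h : hom i j), iota i *m tx z h = tx z1 h *m iota j;
  ext_x2 : forall i j (h : hom i j), tx z h *m p j = p i *m tx z2 h;
  ext_f1 : forall i, iota i *m tf z i = row_mx (tf z1 i) 0;
  ext_f2 : forall i, quot_tf z i = p i *m tf z2 i;
  ext_gp : forall i, tg z i *m p i = 0;
  ext_g0 : forall i, usubmx (tg z i : 'M_(la i + la' i, v i)) = 0;
  ext_g1 : forall i, tg z1 i = 0;
  ext_g2 : forall i, tg z2 i = 0
}.

Lemma row_full_section m n (A : 'M[K]_(m, n)) : row_full A -> exists s, s *m A = 1%:M.
Proof. by move=> /row_fullP. Qed.

Section Fixed.
Variables (z : triple K v (dadd la la')) (z1 : triple K nu la)
  (z2 : triple K nu' la') (iota : forall i, 'M[K]_(nu i, v i))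
  (p : forall i, 'M[K]_(v i, nu' i)).
Hypothesis e : extension_maps z z1 z2 iota p.

Lemma ext_iota_p i : iota i *m p i = 0.
Proof. by apply/sub_kermxP; rewrite (ext_exact e). Qed.

Lemma ext_image m i (A : 'M[K]_(m, v i)) : A *m p i = 0 -> exists D, A = D *m iota i.
Proof. by move/sub_kermxP; rewrite (ext_exact e) => /submxP. Qed.

Lemma moment_map_sub i : iota i *m moment_map z i = moment_map z1 i *m iota i.
Proof.
rewrite /moment_map mulmxDr mulmxDl (ext_g1 e) mulmx0 mul0mx; congr (_ + _).
  rewrite mulmxA (ext_f1 e) -[tg z i](@vsubmxK _ (la i) (la' i)) (ext_g0 e).
  by rewrite mul_row_col mulmx0 mul0mx addr0.
rewrite mulmx_sumr mulmx_suml; apply: eq_bigr => j _.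
rewrite mulmx_sumr mulmx_suml; apply: eq_bigr => h _.
by rewrite -scalemxAr -scalemxAl mulmxA (ext_x1 e) -2!mulmxA (ext_x1 e).
Qed.

Lemma moment_map_quot i : moment_map z i *m p i = p i *m moment_map z2 i.
Proof.
rewrite /moment_map mulmxDl mulmxDr (ext_g2 e) mulmx0 mulmx0; congr (_ + _).
  by rewrite -mulmxA (ext_gp e) mulmx0.
rewrite mulmx_sumr mulmx_suml; apply: eq_bigr => j _.
rewrite mulmx_sumr mulmx_suml; apply: eq_bigr => h _.
by rewrite -scalemxAl -scalemxAr -mulmxA (ext_x2 e) 2!mulmxA (ext_x2 e).
Qed.

Lemma M_circ_sub : M_circ z -> M_circ z1.
Proof.
move=> mu0 i; apply: (row_free_inj (ext_free e i)).
by rewrite -moment_map_sub mu0 mulmx0 mul0mx.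
Qed.

Lemma M_circ_quot : M_circ z -> M_circ z2.
Proof.
move=> mu0 i; have [s sp] := row_full_section (ext_full e i).
by rewrite -[LHS]mul1mx -sp -mulmxA -moment_map_quot mu0 mul0mx mulmx0.
Qed.

Lemma stable_sub : stable z -> stable z1.
Proof.
move=> stz U xU fU i; apply: (row_free_inj (ext_free e i)); rewrite mul0mx.
have gen0 : <<U i *m iota i>>%MS = 0.
  apply: (stz (fun i => <<U i *m iota i>>%MS)) => [k j h|k].
    rewrite genmxE (eqmxMr _ (genmxE _)) -mulmxA (ext_x1 e) mulmxA.
    by apply: submxMr; apply: xU.
  by rewrite genmxE; apply/sub_kermxP; rewrite -mulmxA (ext_f1 e) mul_mx_row
    (sub_kermxP (fU k)) mulmx0 row_mx0.
by apply/eqP; rewrite -submx0 -gen0 genmxE.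
Qed.

(** The image of U in the quotient is stable under x2 and lies in ker f2. *)
Lemma admissible_sub : stable z2 -> forall U, admissible z U ->
  forall i, (U i <= iota i)%MS.
Proof.
move=> st2 U [xU fU _] i; rewrite -(ext_exact e); apply/sub_kermxP.
have gen0 : <<U i *m p i>>%MS = 0.
  apply: (st2 (fun i => <<U i *m p i>>%MS)) => [k j h|k].
    rewrite genmxE (eqmxMr _ (genmxE _)) -mulmxA -(ext_x2 e) mulmxA.
    by apply: submxMr; apply: xU.
  by rewrite genmxE; apply/sub_kermxP; rewrite -mulmxA -(ext_f2 e) /quot_tf fU.
by apply/eqP; rewrite -submx0 -gen0 genmxE.
Qed.

Lemma admissible_image : admissible z (fun i => <<iota i>>%MS).
Proof.
split=> [i j h|i|i].
- by rewrite genmxE (eqmxMr _ (genmxE _)) (ext_x1 e) submxMl.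
- apply/eqP; rewrite -submx0 (eqmxMr _ (genmxE _)) submx0 -/(quot_tf z i) (ext_f2 e).
  by rewrite mulmxA ext_iota_p mul0mx.
- by rewrite genmxE -(ext_exact e); apply/sub_kermxP; apply: (ext_gp e).
Qed.

Lemma is_Vmax_image : stable z2 -> is_Vmax z (fun i => <<iota i>>%MS).
Proof.
move=> st2; split; first exact: admissible_image.
by move=> U aU i; rewrite genmxE; apply: admissible_sub.
Qed.

Lemma induced_on_image : induced_on z (fun i => <<iota i>>%MS) z1 z2.
Proof.
exists iota, p; split=> [i|i||].
- by split; [apply: (ext_free e)|apply: eqmx_sym; apply: genmxE].
- split; first exact: (ext_full e).
  by apply: eqmx_trans (ext_exact e i) (eqmx_sym (genmxE _)).
- by split; [apply: (ext_x1 e)|apply: (ext_f1 e)|apply: (ext_g1 e)].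
- by split; [apply: (ext_x2 e)|apply: (ext_f2 e)|apply: (ext_g2 e)].
Qed.

(** A stable subspace of ker f has an image in the quotient killed by f2,
    hence zero; so it lies in the image of iota, where it is killed by f1. *)
Lemma stable_ext : stable z1 -> stable z2 -> stable z.
Proof.
move=> st1 st2 U xU fU i.
have f0 k : U k *m tf z k = 0 by apply/sub_kermxP.
have f''0 k : U k *m quot_tf z k = 0.
  have : U k *m tf z k = 0 by [].
  rewrite -[tf z k](@hsubmxK _ _ (la k) (la' k)) mul_mx_row -row_mx0.
  by move=> /eq_row_mx[].
have Up0 k : U k *m p k = 0.
  have gen0 : <<U k *m p k>>%MS = 0.
    apply: (st2 (fun i => <<U i *m p i>>%MS)) => [l j h|l].
      rewrite genmxE (eqmxMr _ (genmxE _)) -mulmxA -(ext_x2 e) mulmxA.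
      by apply: submxMr; apply: xU.
    by rewrite genmxE; apply/sub_kermxP; rewrite -mulmxA -(ext_f2 e).
  by apply/eqP; rewrite -submx0 -gen0 genmxE.
have [D UD] : exists D : forall k, 'M_(v k, nu k), forall k, U k = D k *m iota k.
  have D' k : exists D, U k = D *m iota k by apply: ext_image.
  by exists (fun k => projT1 (cid (D' k))) => k; case: (cid (D' k)).
suff gen0 : <<D i>>%MS = 0.
  by rewrite UD (_ : D i = 0) ?mul0mx //; apply/eqP; rewrite -submx0 -gen0 genmxE.
apply: (st1 (fun i => <<D i>>%MS)) => [k j h|k].
  rewrite genmxE (eqmxMr _ (genmxE _)).
  have /submxP[B] := xU k j h; rewrite !UD -mulmxA (ext_x1 e) !mulmxA.
  by move=> /(row_free_inj (ext_free e j)) ->; apply: submxMl.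
rewrite genmxE; apply/sub_kermxP; have := f0 k.
by rewrite UD -mulmxA (ext_f1 e) mul_mx_row -row_mx0 => /eq_row_mx[].
Qed.

(** The preimage under p of an x2-stable subspace of ker f2 is admissible, so
    by maximality it is no larger than V. *)
Lemma stable_quot V : is_Vmax z V -> (forall i, (V i :=: iota i)%MS) -> stable z2.
Proof.
move=> [aV maxV] VE U xU fU i.
pose U' i : 'M[K]_(v i) := kermx (p i *m cokermx (U i)).
have U'P m k (A : 'M_(m, v k)) : (A <= U' k)%MS = (A *m p k <= U k)%MS.
  by apply/sub_kermxP/idP; rewrite mulmxA submxE => /eqP.
have aU' : admissible z U'.
  split=> [k j h|k|k].
  - rewrite U'P -mulmxA (ext_x2 e) mulmxA.
    by apply: submx_trans (xU k j h); apply: submxMr; rewrite -U'P.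
  - rewrite -/(quot_tf z k) (ext_f2 e) mulmxA; apply/sub_kermxP.
    by apply: submx_trans (fU k); rewrite -U'P.
  - by rewrite U'P (ext_gp e) sub0mx.
have [s sp] := row_full_section (ext_full e i).
have : (U i *m s <= kermx (p i))%MS.
  by rewrite (ext_exact e) -VE; apply: submx_trans (maxV _ aU' i);
    rewrite U'P -mulmxA sp mulmx1.
by move/sub_kermxP; rewrite -mulmxA sp mulmx1.
Qed.

Lemma extension_gact c : invertible c ->
  extension_maps (gact c z) z1 z2 (fun i => iota i *m c i) (fun i => invmx (c i) *m p i).
Proof.
move=> uc; split=> [i|i|i|i j h|i j h|i|i|i|i|i|i] /=.
- by rewrite /row_free mxrankMfree ?row_free_unit ?uc //; apply: (ext_free e).
- by rewrite /row_full eqmxMfull ?row_full_unit ?unitmx_inv ?uc //; apply: (ext_full e).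
- apply/eqmxP/andP; split; last first.
    by apply/sub_kermxP; rewrite mulmxA mulmxK ?uc // ext_iota_p.
  apply: (@submx_trans _ _ _ _ _ _ (kermx (invmx (c i) *m p i) *m invmx (c i) *m c i)).
    by rewrite mulmxKV.
  apply: submxMr; rewrite -(ext_exact e); apply/sub_kermxP.
  by rewrite -mulmxA mulmx_ker.
- by rewrite !mulmxA mulmxK // (ext_x1 e).
- by rewrite -!mulmxA mulKVmx // (ext_x2 e).
- by rewrite !mulmxA mulmxK // (ext_f1 e).
- by have := ext_f2 e i; rewrite /quot_tf /= -mulmxA => <-; rewrite mulmx_rsub.
- by rewrite -mulmxA mulKVmx // (ext_gp e).
- by rewrite -mul_usub_mx (ext_g0 e) mul0mx.
- exact: (ext_g1 e).
- exact: (ext_g2 e).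
Qed.

End Fixed.

Lemma induced_extension z (z1 : triple K nu la) (z2 : triple K nu' la') V :
  Z_circ z -> admissible z V -> induced_on z V z1 z2 ->
  exists iota p, extension_maps z z1 z2 iota p /\ forall i, (V i :=: iota i)%MS.
Proof.
move=> [_ g0 _] [_ _ gV] [iota [p [iP pP [x1 f1 g1] [x2 f2 g2]]]].
exists iota, p; split=> [|i]; last by apply: eqmx_sym; case: (iP i).
split=> // i; first by case: (iP i).
- by case: (pP i).
- by have [_ kV] := pP i; have [_ iV] := iP i; apply: eqmx_trans kV (eqmx_sym iV).
- by apply/sub_kermxP; have [_ ->] := pP i.
Qed.

End Extensions.

Section Invariance.
Variables (K : fieldType) (Q : quiver) (nu la : dimvec Q).
Implicit Types (z : triple K nu la) (c : graded_subspace K nu).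

Lemma moment_map_gact c z i : invertible c ->
  moment_map (gact c z) i = invmx (c i) *m moment_map z i *m c i.
Proof.
move=> uc; rewrite /moment_map mulmxDr mulmxDl /= !mulmxA; congr (_ + _).
rewrite mulmx_sumr mulmx_suml; apply: eq_bigr => j _.
rewrite mulmx_sumr mulmx_suml; apply: eq_bigr => h _.
by rewrite -scalemxAr -scalemxAl !mulmxA mulmxK.
Qed.

Lemma M_circ_gact c z : invertible c -> M_circ z -> M_circ (gact c z).
Proof. by move=> uc mu0 i; rewrite moment_map_gact // mu0 mulmx0 mul0mx. Qed.

Lemma stable_gact c z : invertible c -> stable z -> stable (gact c z).
Proof.
move=> uc st U xU fU i.
have U0 : U i *m invmx (c i) = 0.
  apply: (st (fun i => U i *m invmx (c i))) => [k j h|k].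
    have := submxMr (invmx (c j)) (xU k j h).
    by rewrite /= !mulmxA mulmxK.
  by have /sub_kermxP := fU k; rewrite /= mulmxA => ?; apply/sub_kermxP.
by rewrite -[U i](mulmxKV (uc i)) U0 mul0mx.
Qed.

Lemma seminilpotent_gact c z : invertible c ->
  seminilpotent (tx z) -> seminilpotent (tx (gact c z)).
Proof.
move=> uc [r [F [F0 Fr Fflag Fx]]]; exists r, (fun k i => F k i *m c i); split.
- move=> i; apply: eqmx_trans (eqmxMr _ (F0 i)) _; rewrite mul1mx.
  by apply/eqmxP; rewrite submx1 sub1mx row_full_unit uc.
- by move=> i; rewrite Fr mul0mx.
- move=> k kr; have [dF [i iF]] := Fflag k kr; split=> [j|].
    by apply: submxMr.
  by exists i => j ji; apply: eqmxMr; apply: iF.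
- move=> k kr i j h; rewrite /= !mulmxA mulmxK //.
  by apply: submxMr; apply: Fx.
Qed.

Lemma L_semi_gact c z : invertible c -> L_semi z -> L_semi (gact c z).
Proof.
move=> uc [[mu0 st] g0 sn]; split; first split.
- exact: M_circ_gact.
- exact: stable_gact.
- by move=> i; rewrite /= g0 mul0mx.
- exact: seminilpotent_gact.
Qed.

Lemma L_semi_orb z z' : orb z = orb z' -> L_semi z -> L_semi z'.
Proof. by move=> /orb_eqP[c uc ->]; apply: L_semi_gact. Qed.

End Invariance.

Section Tensor.
Variables (K : fieldType) (Q : quiver) (la la' nu nu' : dimvec Q).
Local Notation E := (triple K (dadd nu nu') (dadd la la')).
Implicit Types c : graded_subspace K (dadd nu nu').

(** Equal images of iota force iota' = a iota and p' = p b with a and b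
    invertible, and these conjugate the induced triples. *)
Lemma extension_unique (z : E) (z1 : triple K nu la) (z2 : triple K nu' la') iota p
    (z1' : triple K nu la) (z2' : triple K nu' la') iota' p' :
  extension_maps z z1 z2 iota p -> extension_maps z z1' z2' iota' p' ->
  (forall i, (iota i :=: iota' i)%MS) -> orb z1 = orb z1' /\ orb z2 = orb z2'.
Proof.
move=> e e' ii'.
pose a i := iota' i *m pinvmx (iota i).
have aE i : iota' i = a i *m iota i by rewrite /a mulmxKpV // ii'.
have ua : invertible a.
  move=> i; rewrite -row_free_unit /row_free -(mxrankMfree _ (ext_free e i)) -aE.
  exact: (ext_free e').
pose b i := pinvmx (p i) *m p' i.
have sp i : pinvmx (p i) *m p i = 1%:M.
  by rewrite -[pinvmx _]mul1mx mulmxKpV // sub1mx (ext_full e).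
have bE i : p' i = p i *m b i.
  apply/eqP; rewrite -subr_eq0 /b mulmxA -[X in X - _]mul1mx -mulmxBl; apply/eqP.
  apply/sub_kermxP; rewrite (ext_exact e') -ii' -(ext_exact e); apply/sub_kermxP.
  by rewrite mulmxBl mul1mx -mulmxA sp mulmx1 subrr.
have ub : invertible b.
  move=> i; have [s' sp'] := row_full_section (ext_full e' i).
  by rewrite bE mulmxA in sp'; have [] := mulmx1_unit sp'.
have pI i m (A B : 'M_(nu' i, m)) : p i *m A = p i *m B -> A = B.
  by move=> /(congr1 (mulmx (pinvmx (p i)))); rewrite !mulmxA sp !mul1mx.
split; apply/orb_eqP.
  exists (fun i => invmx (a i)); first exact: invertible_inv.
  apply: triple_ext => [i j h|i|i] /=; last by rewrite (ext_g1 e) (ext_g1 e') mul0mx.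
    rewrite invmxK; apply: (canRL (mulmxK (ua j))).
    apply: (row_free_inj (ext_free e j)).
    by rewrite -mulmxA -aE -(ext_x1 e') aE -!mulmxA (ext_x1 e).
  have := ext_f1 e' i; rewrite aE -mulmxA (ext_f1 e) mul_mx_row mulmx0 invmxK.
  by move=> /eq_row_mx[].
exists b => //.
apply: triple_ext => [i j h|i|i] /=; last by rewrite (ext_g2 e) (ext_g2 e') mul0mx.
  rewrite -mulmxA; apply: (canRL (mulKmx (ub i))); apply: pI.
  by rewrite mulmxA -bE -(ext_x2 e') bE !mulmxA (ext_x2 e).
apply: (canRL (mulKmx (ub i))); apply: pI.
by rewrite mulmxA -bE -(ext_f2 e') (ext_f2 e).
Qed.

Lemma is_Vmax_unique v (z : triple K v (dadd la la')) V V' :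
  is_Vmax z V -> is_Vmax z V' -> forall i, (V i :=: V' i)%MS.
Proof.
by move=> [aV mV] [aV' mV'] i; apply/eqmxP; rewrite mV' // mV.
Qed.

Lemma induced_extension_maps (z : E) (z1 : triple K nu la) (z2 : triple K nu' la') :
  Ztilde z -> induced z z1 z2 ->
  exists iota p V, [/\ extension_maps z z1 z2 iota p, is_Vmax z V &
                       forall i, (V i :=: iota i)%MS].
Proof.
move=> [[[Zz _] _] _] [V [maxV ind]].
have [iota [p [e Vi]]] := induced_extension Zz maxV.1 ind.
by exists iota, p, V.
Qed.

Lemma induced_unique (z : E) z1 z2 z1' z2' : @Ztilde _ _ la la' nu nu' z ->
  induced z z1 z2 -> induced z z1' z2' -> orb z1 = orb z1' /\ orb z2 = orb z2'.
Proof.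
move=> Zz /(induced_extension_maps Zz)[iota [p [V [e mV Vi]]]].
move=> /(induced_extension_maps Zz)[iota' [p' [V' [e' mV' Vi']]]].
apply: extension_unique e e' _ => i.
apply: eqmx_trans (eqmx_sym (Vi i)) _; apply: eqmx_trans (Vi' i).
exact: is_Vmax_unique mV mV' i.
Qed.

(** The dimensions of the induced triples are existentially quantified in the
    definition of [Ztilde_circ]; the rank of V, which is unique, identifies
    them with nu and nu'. *)
Lemma Ztilde_induced (z : E) : @Ztilde _ _ la la' nu nu' z -> exists z1 z2,
  [/\ induced z z1 z2, seminilpotent (tx z1) & seminilpotent (tx z2)].
Proof.
move=> [[[Zz [V [mV [m [m' [z1 [z2 [ind s1 s2]]]]]]]] [V' [mV' rV']]] _].
have mE : m = nu.
  apply/funext => i; rewrite -rV' -(is_Vmax_unique mV mV' i).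
  by have [iota [p [iP _ _ _]]] := ind; have [/eqP ri <-] := iP i.
have m'E : m' = nu'.
  apply/funext => i; have := rV' i; rewrite -(is_Vmax_unique mV mV' i).
  have [iota [p [_ pP _ _]]] := ind; have [/eqP pr kV] := pP i; rewrite -kV.
  have := rank_leq_row (p i); rewrite mxrank_ker pr => le1 eq1.
  by apply: (@addnI (nu i)); rewrite -{1}eq1 subnK.
subst m m'.
by exists z1, z2; split=> //; exists V.
Qed.

Lemma induced_L_semi (z : E) z1 z2 : @Ztilde _ _ la la' nu nu' z -> induced z z1 z2 ->
  L_semi z1 /\ L_semi z2.
Proof.
move=> Zz ind; have [z1' [z2' [ind' s1' s2']]] := Ztilde_induced Zz.
have [o1 o2] := induced_unique Zz ind' ind.
have [iota [p [V [e mV Vi]]]] := induced_extension_maps Zz ind.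
have [[[[mu0 _ _] _] _] st] := Zz.
split; split; rewrite ?/M_stable.
- by split; [apply: M_circ_sub e _|apply: stable_sub e _].
- exact: (ext_g1 e).
- by have /orb_eqP[c uc ->] := o1; apply: seminilpotent_gact.
- by split; [apply: M_circ_quot e _|apply: stable_quot e _ mV _].
- exact: (ext_g2 e).
- by have /orb_eqP[c uc ->] := o2; apply: seminilpotent_gact.
Qed.

Lemma extension_Ztilde (z : E) (z1 : triple K nu la) (z2 : triple K nu' la') iota p :
  M_circ z -> L_semi z1 -> L_semi z2 -> extension_maps z z1 z2 iota p ->
  Ztilde z /\ induced z z1 z2.
Proof.
move=> mu0 [[_ st1] g1 sn1] [[_ st2] g2 sn2] e.
have mV := is_Vmax_image e st2; have ind := induced_on_image e.
have stz := stable_ext e st1 st2.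
split; last by exists (fun i => <<iota i>>%MS).
split=> //; split; last first.
  exists (fun i => <<iota i>>%MS); split=> // i.
  by rewrite genmxE; apply/eqP; apply: (ext_free e).
split; first by split=> //; [apply: (ext_g0 e)|exists (fun i => <<iota i>>%MS); case: mV].
exists (fun i => <<iota i>>%MS); split=> //.
by exists nu, nu', z1, z2.
Qed.

Lemma Ztilde_gact c (z : E) z1 z2 : @Ztilde _ _ la la' nu nu' z -> invertible c ->
  induced z z1 z2 -> Ztilde (gact c z) /\ induced (gact c z) z1 z2.
Proof.
move=> Zz uc ind; have [L1 L2] := induced_L_semi Zz ind.
have [iota [p [V [e mV Vi]]]] := induced_extension_maps Zz ind.
have [[[[mu0 _ _] _] _] st] := Zz.
apply: extension_Ztilde L1 L2 (extension_gact e uc).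
exact: M_circ_gact.
Qed.

Lemma Ztilde_orb (z z' : E) : orb z = orb z' ->
  @Ztilde _ _ la la' nu nu' z -> Ztilde z'.
Proof.
move=> /orb_eqP[c uc ->] Zz; have [z1 [z2 [ind _ _]]] := Ztilde_induced Zz.
by case: (Ztilde_gact Zz uc ind).
Qed.

Lemma induced_orb (z z' : E) z1 z2 : @Ztilde _ _ la la' nu nu' z -> orb z = orb z' ->
  induced z z1 z2 -> induced z' z1 z2.
Proof.
by move=> Zz /orb_eqP[c uc ->] ind; case: (Ztilde_gact Zz uc ind).
Qed.

End Tensor.

(** * Block triangular triples *)

Section Blocks.
Variables (K : fieldType) (Q : quiver) (la la' nu nu' : dimvec Q).
Local Notation E1 := (triple K nu la).
Local Notation E2 := (triple K nu' la').
Local Notation E := (triple K (dadd nu nu') (dadd la la')).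

Definition off_x (w : E) i j (h : hom i j) : 'M[K]_(nu' i, nu j) :=
  dlsubmx (tx w h : 'M_(nu i + nu' i, nu j + nu' j)).
Definition off_f (w : E) i : 'M[K]_(nu' i, la i) :=
  dlsubmx (tf w i : 'M_(nu i + nu' i, la i + la' i)).
Definition off_g (w : E) i : 'M[K]_(la' i, nu i) :=
  dlsubmx (tg w i : 'M_(la i + la' i, nu i + nu' i)).

(** Only the lower left blocks of w are used, so the triples w serve as
    coordinates for (y, u, g') without a further type. *)
Definition block_triple (z1 : E1) (z2 : E2) (w : E) : E :=
  Triple (fun i j h => block_mx (tx z1 h) 0 (off_x w h) (tx z2 h))
         (fun i => block_mx (tf z1 i) 0 (off_f w i) (tf z2 i))
         (fun i => block_mx 0 0 (off_g w i) 0).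

(** The lower left block of the moment map of [block_triple z1 z2 w]. *)
Definition off_moment (z1 : E1) (z2 : E2) (w : E) i : 'M[K]_(nu' i, nu i) :=
  tf z2 i *m off_g w i +
  \sum_(j : vertex Q) \sum_(h : hom i j) eps K h *:
    (off_x w h *m tx z1 (bar_hom h) + tx z2 h *m off_x w (bar_hom h)).

Lemma block_mx_sum (I : finType) m1 m2 n1 n2
    (A : I -> 'M[K]_(m1, n1)) (C : I -> 'M[K]_(m2, n1)) (D : I -> 'M[K]_(m2, n2)) :
  \sum_i block_mx (A i) 0 (C i) (D i) =
  block_mx (\sum_i A i) 0 (\sum_i C i) (\sum_i D i).
Proof.
elim: (index_enum I) => [|i r IHr]; first by rewrite !big_nil block_mx0.
by rewrite !big_cons IHr add_block_mx addr0.
Qed.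

Lemma moment_map_block_triple z1 z2 w i : (forall i, tg z1 i = 0) -> (forall i, tg z2 i = 0) ->
  moment_map (block_triple z1 z2 w) i =
  block_mx (moment_map z1 i) 0 (off_moment z1 z2 w i) (moment_map z2 i).
Proof.
move=> g1 g2; rewrite /moment_map /off_moment /= g1 g2 !mulmx0 mulmx_block.
rewrite !(mulmx0, mul0mx, addr0, add0r).
under eq_bigr => j _.
  under eq_bigr => h _ do
    rewrite mulmx_block scale_block_mx !(mulmx0, mul0mx, addr0, add0r) scaler0.
  rewrite block_mx_sum; over.
by rewrite block_mx_sum /= add_block_mx !add0r.
Qed.

Lemma extension_block_triple z1 z2 w : (forall i, tg z1 i = 0) -> (forall i, tg z2 i = 0) ->
  extension_maps (block_triple z1 z2 w) z1 z2
    (fun i => row_mx 1%:M 0) (fun i => col_mx 0 1%:M).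
Proof.
move=> g1 g2; split=> // [i|i|i|i j h|i j h|i|i|i|i].
- by apply/row_freeP; exists (col_mx 1%:M 0); rewrite mul_row_col mulmx1 mulmx0 addr0.
- by apply/row_fullP; exists (row_mx 0 1%:M); rewrite mul_row_col mulmx1 mulmx0 add0r.
- apply/eqmxP/andP; split; last first.
    by apply/sub_kermxP; rewrite mul_row_col mulmx0 mul0mx addr0.
  have := mulmx_ker (col_mx (0 : 'M[K]_(nu i, nu' i)) 1%:M).
  set A := kermx _; rewrite -[A in A *m _](@hsubmxK _ _ (nu i) (nu' i)) mul_row_col.
  rewrite mulmx0 mulmx1 add0r => rA0.
  have -> : A = lsubmx (A : 'M_(_, nu i + nu' i)) *m row_mx 1%:M 0.
    by rewrite mul_mx_row mulmx1 mulmx0 -[LHS](@hsubmxK _ _ (nu i) (nu' i)) rA0.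
  exact: submxMl.
- by rewrite /= mul_row_block mul_mx_row !mul1mx !mul0mx !mulmx0 mulmx1 !addr0.
- by rewrite /= mul_block_col mul_col_mx !mulmx0 !mulmx1 !mul0mx mul1mx !add0r.
- by rewrite /= mul_row_block !mul1mx !mul0mx !addr0.
- by rewrite /quot_tf /= block_mxEv -[col_mx (row_mx _ _) _]block_mxEv block_mxEh
    row_mxKr mul_col_mx mul0mx mul1mx.
- by rewrite /= mul_block_col !mulmx0 !mul0mx !addr0 col_mx0.
- by rewrite /= block_mxEv col_mxKu row_mx0.
Qed.

(** Complementing the image of iota by that of a section s of p gives the
    basis; the inverse of the base change has p as its last columns. *)
Lemma extension_block_form z z1 z2 iota p : extension_maps z z1 z2 iota p ->
  exists c, [/\ invertible c,
    forall i, c i = row_mx (lsubmx (c i : 'M_(nu i + nu' i))) (p i) &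
    gact c z = block_triple z1 z2 (gact c z)].
Proof.
move=> e.
have rE i : exists r, iota i *m r = 1%:M by apply/row_freeP/(ext_free e).
have sE i : exists s, s *m p i = 1%:M by apply/row_fullP/(ext_full e).
have [r0 r0P] : exists r : forall i, 'M_(_, _), forall i, iota i *m r i = 1%:M.
  by exists (fun i => projT1 (cid (rE i))) => i; case: (cid (rE i)).
have [s sP] : exists s : forall i, 'M_(_, _), forall i, s i *m p i = 1%:M.
  by exists (fun i => projT1 (cid (sE i))) => i; case: (cid (sE i)).
(* correct the right inverse r0 of iota so that it is also killed by s *)
pose r i := (1%:M - p i *m s i) *m r0 i.
have ir i : iota i *m r i = 1%:M.
  by rewrite /r mulmxA mulmxBr mulmx1 mulmxA (ext_iota_p e) mul0mx subr0.
have sr i : s i *m r i = 0.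
  by rewrite /r mulmxA mulmxBr mulmx1 mulmxA sP mul1mx subrr mul0mx.
pose c i : 'M[K]_(nu i + nu' i) := row_mx (r i) (p i).
pose d i : 'M[K]_(nu i + nu' i) := col_mx (iota i) (s i).
have dc i : d i *m c i = 1%:M.
  by rewrite mul_col_row ir sr sP (ext_iota_p e) -scalar_mx_block.
have uc : @invertible K Q (dadd nu nu') c by move=> i; case: (mulmx1_unit (dc i)).
have Vc i : invmx (c i) = d i.
  by rewrite -[LHS]mul1mx -(dc i) (mulmxK (uc i)).
exists c; split=> //; first by move=> i; rewrite row_mxKl.
apply: triple_ext => [i j h|i|i].
- rewrite {1}/gact /= /off_x /= Vc mul_col_mx (ext_x1 e) mul_col_row.
  rewrite -!mulmxA ir (ext_iota_p e) mulmx0 mulmx1 (ext_x2 e) !mulmxA sP mul1mx.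
  by rewrite /off_x /= block_mxKdl.
- rewrite {1}/gact /= /off_f /= Vc mul_col_mx (ext_f1 e).
  rewrite -[s i *m tf z i](@hsubmxK _ _ (la i) (la' i)) -mulmx_rsub.
  by rewrite -/(quot_tf z i) (ext_f2 e) mulmxA sP mul1mx -/block_mx block_mxKdl.
- pose g' := dsubmx (tg z i : 'M_(la i + la' i, dadd nu nu' i)).
  have gE : tg z i = col_mx 0 g' by rewrite -(ext_g0 e) vsubmxK.
  have gp0 : g' *m p i = 0.
    by have := ext_gp e i; rewrite gE mul_col_mx -col_mx0 => /eq_col_mx[].
  by rewrite /gact /= /off_g /= gE mul_col_row gp0 !mul0mx block_mxKdl.
Qed.

End Blocks.

Section Coordinates.
Variables (K : fieldType) (Q : quiver) (nu la : dimvec Q).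
Local Notation N := #|entry_index nu la|.

Definition x_index i j (h : hom i j) (a : 'I_(nu i)) (b : 'I_(nu j)) : entry_index nu la :=
  inl (existT (fun ij => (hom ij.1 ij.2 * ('I_(nu ij.1) * 'I_(nu ij.2)))%type)
    (i, j) (h, (a, b))).
Definition f_index i (a : 'I_(nu i)) (b : 'I_(la i)) : entry_index nu la :=
  inr (inl (existT (fun i => ('I_(nu i) * 'I_(la i))%type) i (a, b))).
Definition g_index i (a : 'I_(la i)) (b : 'I_(nu i)) : entry_index nu la :=
  inr (inr (existT (fun i => ('I_(la i) * 'I_(nu i))%type) i (a, b))).

Definition of_row (r : 'rV[K]_N) : triple K nu la :=
  Triple (fun i j h => \matrix_(a, b) r 0 (enum_rank (x_index h a b)))
         (fun i => \matrix_(a, b) r 0 (enum_rank (f_index a b)))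
         (fun i => \matrix_(a, b) r 0 (enum_rank (g_index a b))).

Lemma of_row_surj z : exists r, of_row r = z.
Proof.
exists (\row_k entries z k); apply: triple_ext => [i j h|i|i] /=;
  by apply/matrixP => a b; rewrite !mxE /entries enum_rankK.
Qed.

End Coordinates.

Section OppositeArrows.
Variable Q : quiver.

Lemma bar_homK (i j : vertex Q) (h : hom i j) : bar_hom (bar_hom h) = h.
Proof. by apply: val_inj; case: h => [[a|a] ?]. Qed.

Lemma eps_bar (K : pzRingType) (i j : vertex Q) (h : hom i j) : eps K (bar_hom h) = - eps K h.
Proof. by case: h => [[a|a] ?]; rewrite /eps //= opprK. Qed.

(** Taking opposites is a bijection from hom i j to hom j i. *)
Lemma sum_bar (V : nmodType) (F : forall i j : vertex Q, hom i j -> V) :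
  \sum_i \sum_j \sum_(h : hom i j) F i j h =
  \sum_i \sum_j \sum_(h : hom i j) F j i (bar_hom h).
Proof.
rewrite exchange_big; apply: eq_bigr => i _; apply: eq_bigr => j _.
rewrite (reindex (@bar_hom Q i j)) //.
by exists (@bar_hom Q j i) => h _; rewrite bar_homK.
Qed.

End OppositeArrows.

(** * The linear system of block triangular triples *)

Section System.
Variables (K : fieldType) (Q : quiver) (la la' nu nu' : dimvec Q).
Local Notation E1 := (triple K nu la).
Local Notation E2 := (triple K nu' la').
Local Notation E := (triple K (dadd nu nu') (dadd la la')).
Local Notation N := #|entry_index (dadd nu nu') (dadd la la')|.

(** Coordinates of the space of families of matrices in which [off_moment]
    takes its values. *)
Definition off_index : finType := {i : vertex Q & ('I_(nu' i) * 'I_(nu i))%type}.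

Section Fixed.
Variables (z1 : E1) (z2 : E2).

Definition off_moment_row (r : 'rV[K]_N) : 'rV[K]_#|off_index| :=
  \row_l let k : off_index := enum_val l in
    off_moment z1 z2 (of_row r) (tag k) (tagged k).1 (tagged k).2.

Lemma off_x_linear a r r' i j (h : hom i j) :
  off_x (of_row (a *: r + r') : E) h = a *: off_x (of_row r) h + off_x (of_row r') h.
Proof. by apply/matrixP => s t; rewrite !mxE. Qed.

Lemma off_g_linear a r r' i :
  off_g (of_row (a *: r + r') : E) i = a *: off_g (of_row r) i + off_g (of_row r') i.
Proof. by apply/matrixP => s t; rewrite !mxE. Qed.

Lemma off_moment_linear a r r' i : off_moment z1 z2 (of_row (a *: r + r')) i =
  a *: off_moment z1 z2 (of_row r) i + off_moment z1 z2 (of_row r') i.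
Proof.
rewrite /off_moment off_g_linear mulmxDr -scalemxAr scalerDr [RHS]addrACA; congr (_ + _).
rewrite scaler_sumr -big_split; apply: eq_bigr => j _ /=.
rewrite scaler_sumr -big_split; apply: eq_bigr => h _ /=.
rewrite !off_x_linear mulmxDl mulmxDr -scalemxAl -scalemxAr.
by rewrite addrACA -[a *: _ + a *: _]scalerDr [LHS]scalerDr !scalerA (mulrC a).
Qed.

Lemma off_moment_row_linear : linear off_moment_row.
Proof.
move=> a r r'; apply/rowP => l; rewrite [LHS]mxE /= off_moment_linear [LHS]mxE [RHS]mxE.
by congr (_ + _); [rewrite [LHS]mxE [RHS]mxE; congr (_ * _)|]; rewrite [RHS]mxE.
Qed.
HB.instance Definition _ := GRing.isLinear.Build K 'rV[K]_N 'rV[K]_#|off_index| *:%R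
  off_moment_row off_moment_row_linear.

Definition system : 'M[K]_(N, #|off_index|) := lin1_mx off_moment_row.

Lemma systemP r : r *m system = 0 <-> forall i, off_moment z1 z2 (of_row r) i = 0.
Proof.
rewrite mul_rV_lin1 /=; split=> [r0 i|off0]; last first.
  by apply/rowP => l; rewrite [LHS]mxE /= off0 !mxE.
apply/matrixP => a b; rewrite [RHS]mxE.
have := congr1 (fun A : 'rV_ _ => A 0 (enum_rank
  (Tagged (fun i => ('I_(nu' i) * 'I_(nu i))%type) (a, b)))) r0.
by rewrite /= [LHS]mxE [RHS]mxE /= enum_rankK /=.
Qed.

End Fixed.

End System.

Section Surjectivity.
Variables (K : numFieldType) (Q : quiver) (la la' nu nu' : dimvec Q).
Local Notation E1 := (triple K nu la).
Local Notation E2 := (triple K nu' la').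
Local Notation E := (triple K (dadd nu nu') (dadd la la')).

(** Nondegeneracy of the trace form. The value 0 or 1 lets several such
    identities be summed without cancellation in characteristic zero. *)
Lemma trace_dual m n (A : 'M[K]_(m, n)) : exists B, \tr (A *m B) = (A != 0)%:R.
Proof.
have [->|/matrix0Pn[a [b Aab]]] := eqVneq A 0.
  by exists 0; rewrite mul0mx mxtrace0.
exists ((A a b)^-1 *: delta_mx b a).
rewrite -scalemxAr mxtraceZ /mxtrace (bigD1 a) //= big1 => [|i /negPf ia].
  rewrite mxE (bigD1 b) //= big1 => [|k /negPf kb]; rewrite !mxE ?kb ?mulr0 //.
  by rewrite !eqxx mulr1 !addr0 mulVf.
by rewrite mxE big1 // => k _; rewrite !mxE ia andbF mulr0.
Qed.

Variables (z1 : E1) (z2 : E2).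
Hypothesis st2 : stable z2.

(** The key duality. Varying g' shows that C f2 = 0. Varying y, and collecting
    the two terms that contain a given y_h, shows that C intertwines x1 and
    x2: the sign eps changes between h and bar h, so the two terms come with
    opposite signs. Hence the image of C is x2-stable in ker f2, and stability
    makes it zero. *)
Lemma off_moment_pairing (C : forall i, 'M[K]_(nu i, nu' i)) :
  (forall w : E, \sum_i \tr (C i *m off_moment z1 z2 w i) = 0) -> forall i, C i = 0.
Proof.
move=> CM.
have Cf i : C i *m tf z2 i = 0.
  have [G GP] : exists G : forall i, 'M_(_, _), forall i,
      \tr (C i *m tf z2 i *m G i) = (C i *m tf z2 i != 0)%:R.
    have GE i' := trace_dual (C i' *m tf z2 i').
    by exists (fun i => projT1 (cid (GE i))) => i'; case: (cid (GE i')).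
  pose w : E := Triple (fun _ _ _ => 0) (fun=> 0) (fun i => block_mx 0 0 (G i) 0).
  have := CM w; under eq_bigr => k _.
    rewrite /off_moment big1 ?addr0 => [|j _]; last first.
      apply: big1 => h _.
      have x0 a b (h' : hom a b) : off_x w h' = 0.
        by rewrite /off_x /=; apply/matrixP => s t; rewrite !mxE.
      by rewrite !x0 mul0mx mulmx0 addr0 scaler0.
    rewrite /off_g /= block_mxKdl mulmxA GP; over.
  move=> /(psumr_eq0P (fun _ _ => ler0n _ _))/(_ i isT)/eqP.
  by rewrite pnatr_eq0 eqb0 negbK => /eqP.
have Cx i j (h : hom i j) : tx z1 h *m C j = C i *m tx z2 h.
  pose D i j (h : hom i j) := eps K h *: (tx z1 (bar_hom h) *m C i - C j *m tx z2 (bar_hom h)).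
  suff D0 a b (k : hom a b) : D a b k = 0.
    have /eqP := D0 _ _ (bar_hom h); rewrite /D bar_homK scaler_eq0 subr_eq0.
    by rewrite /eps; case: ifP => _; rewrite ?oppr_eq0 oner_eq0 => /eqP.
  have [Y YP] : exists Y : forall i j, hom i j -> 'M_(_, _), forall i j (h : hom i j),
      \tr (D i j h *m Y i j h) = (D i j h != 0)%:R.
    have YE i' j' h' := trace_dual (D i' j' h').
    by exists (fun i j h => projT1 (cid (YE i j h))) => i' j' h'; case: (cid (YE i' j' h')).
  pose w : E := Triple (fun i j h => block_mx 0 0 (Y i j h) 0) (fun=> 0) (fun=> 0).
  have := CM w.
  have -> : \sum_i \tr (C i *m off_moment z1 z2 w i) =
     \sum_i \sum_j \sum_(h : hom i j) \tr (D i j h *m Y i j h).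
    transitivity (\sum_i \sum_j \sum_(h : hom i j)
        (eps K h * \tr (tx z1 (bar_hom h) *m C i *m Y i j h) +
         eps K h * \tr (C i *m tx z2 h *m Y j i (bar_hom h)))).
      apply: eq_bigr => a' _; rewrite /off_moment.
      have -> : off_g w a' = 0 by apply/matrixP => s t; rewrite !mxE.
      rewrite mulmx0 add0r.
      rewrite mulmx_sumr raddf_sum; apply: eq_bigr => b' _ /=.
      rewrite mulmx_sumr raddf_sum; apply: eq_bigr => h' _ /=.
      rewrite /off_x /= !block_mxKdl -scalemxAr mxtraceZ mulmxDr mxtraceD mulrDr.
      by rewrite !mulmxA [X in _ * X + _ = _]mxtrace_mulC mulmxA.
    under eq_bigr do under eq_bigr do rewrite big_split.
    under eq_bigr do rewrite big_split.
    rewrite big_split /= [X in _ + X]sum_bar -big_split.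
    apply: eq_bigr => a' _ /=; rewrite -big_split.
    apply: eq_bigr => b' _ /=; rewrite -big_split.
    apply: eq_bigr => h' _ /=; rewrite bar_homK eps_bar /D -scalemxAl mxtraceZ.
    by rewrite mulmxBl linearB /= mulrBr mulNr.
  under eq_bigr do under eq_bigr do under eq_bigr do rewrite YP.
  have ge0 a' b' : 0 <= \sum_(h : hom a' b') (D a' b' h != 0)%:R :> K.
    by apply: sumr_ge0 => *; apply: ler0n.
  move=> /(psumr_eq0P (fun _ _ => sumr_ge0 _ (fun _ _ => ge0 _ _)))/(_ a isT).
  move=> /(psumr_eq0P (fun _ _ => ge0 _ _))/(_ b isT).
  move=> /(psumr_eq0P (fun _ _ => ler0n _ _))/(_ k isT)/eqP.
  by rewrite pnatr_eq0 eqb0 negbK => /eqP.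
suff gen0 k : <<C k>>%MS = 0 by move=> k; apply/eqP; rewrite -submx0 -gen0 genmxE.
apply: (st2 (U := fun i => <<C i>>%MS)) => [i j h|i].
  by rewrite genmxE (eqmxMr _ (genmxE _)) -Cx submxMl.
by rewrite genmxE; apply/sub_kermxP.
Qed.

(** A column c killed by the system is, via the trace form, a family C as in
    [off_moment_pairing]. *)
Lemma system_full : row_full (system z1 z2).
Proof.
have coker0 (c : 'cV[K]_#|off_index nu nu'|) : system z1 z2 *m c = 0 -> c = 0.
  move=> Mc.
  pose C i : 'M[K]_(nu i, nu' i) := \matrix_(b, a)
    c (enum_rank (Tagged (fun i => ('I_(nu' i) * 'I_(nu i))%type) (a, b))) 0.
  have C0 : forall i, C i = 0.
    apply: off_moment_pairing => w; have [r <-] := of_row_surj w.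
    have := congr1 (fun A : 'M_1 => A 0 0) (mulmxA r (system z1 z2) c).
    rewrite Mc mulmx0 mul_rV_lin1 /= [LHS]mxE [RHS]mxE => sum0; apply: etrans (esym sum0).
    rewrite (reindex (@enum_rank (off_index nu nu'))) /=; last first.
      by apply: onW_bij; apply: enum_rank_bij.
    rewrite [RHS](eq_bigr (fun k : off_index nu nu' =>
        off_moment z1 z2 (of_row r) (tag k) (tagged k).1 (tagged k).2 *
        C (tag k) (tagged k).2 (tagged k).1)); last first.
      by move=> [i [a b]] _; rewrite [X in X * _ = _]mxE /= enum_rankK /= [C _ _ _]mxE.
    rewrite -(@sig_big_dep _ _ _ _ (fun i => ('I_(nu' i) * 'I_(nu i))%type) xpredT
      (fun _ => xpredT) (fun i ab => off_moment z1 z2 (of_row r) i ab.1 ab.2 *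
        C i ab.2 ab.1)).
    apply: eq_bigr => i _; rewrite mxtrace_mulC /mxtrace.
    rewrite -(pair_bigA _ (fun a b => off_moment z1 z2 (of_row r) i a b * C i b a)).
    by apply: eq_bigr => a _; rewrite [LHS]mxE.
  apply/colP => l; rewrite [RHS]mxE.
  have := C0 (tag (enum_val l)).
  move=> /matrixP/(_ (tagged (enum_val l)).2 (tagged (enum_val l)).1).
  by rewrite [LHS]mxE [RHS]mxE; case: (enum_val l) (enum_valK l) => i [a b] /= <-.
rewrite /row_full eqn_leq rank_leq_col /= -subn_eq0 -mxrank_coker mxrank_eq0.
apply/eqP/matrixP => i j; rewrite [RHS]mxE.
have /coker0/colP/(_ i) : system z1 z2 *m col j (cokermx (system z1 z2)) = 0.
  by rewrite colE mulmxA mulmx_coker mul0mx.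
by rewrite !mxE.
Qed.

End Surjectivity.

Section RegularSystem.
Variables (K : fieldType) (Q : quiver) (la la' nu nu' : dimvec Q) (T : Type).
Variables (reg : set (T -> K)) (z1 : T -> triple K nu la) (z2 : T -> triple K nu' la').
Hypotheses (regR : function_ring reg) (rz1 : reg_triple reg z1) (rz2 : reg_triple reg z2).
Local Notation N := #|entry_index (dadd nu nu') (dadd la la')|.

Lemma reg_system : reg_mx reg (fun t => system (z1 t) (z2 t)).
Proof.
have [rx1 rf1 rg1] := rz1; have [rx2 rf2 rg2] := rz2.
have rM w i : reg_mx reg (fun t => off_moment (z1 t) (z2 t) w i).
  apply: reg_mxD => //; first by apply: reg_mulmx => //; apply: reg_mx_const.
  apply: reg_mx_sum => // j _; apply: reg_mx_sum => // h _.
  apply: reg_mxZ => //; first exact: reg_const.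
  by apply: reg_mxD => //; apply: reg_mulmx => //; apply: reg_mx_const.
apply: (reg_mxP (F := fun t k l => off_moment (z1 t) (z2 t) (of_row (delta_mx 0 k))
  (tag (enum_val l)) (tagged (enum_val l)).1 (tagged (enum_val l)).2)) => [t k l|k l].
  by rewrite [LHS]mxE /= [LHS]mxE.
exact: rM.
Qed.

Lemma reg_block_triple (r : T -> 'rV[K]_N) : reg_mx reg r ->
  reg_triple reg (fun t => block_triple (z1 t) (z2 t) (of_row (r t))).
Proof.
have [rx1 rf1 rg1] := rz1; have [rx2 rf2 rg2] := rz2.
move=> rr; split=> [i j h|i|i]; apply: reg_block_mx => //;
  try exact: reg_mx_const; move=> a b; under eq_fun do rewrite !mxE; exact: rr.
Qed.


(** Subtracting from r0 its error r0 M times (S M)^-1 S, with M the system at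
    (y1, y2), gives a solution at (y1, y2); multiplying by det (S M) makes
    this polynomial in the triples, and a solution at all of them. It equals
    r0 where S inverts the system and r0 solves it. *)
Definition section_row (S : 'M[K]_(#|off_index nu nu'|, N)) (r0 : 'rV[K]_N)
    (y1 : triple K nu la) (y2 : triple K nu' la') : 'rV[K]_N :=
  let M := system y1 y2 in
  \det (S *m M) *: r0 - r0 *m M *m \adj (S *m M) *m S.

Lemma section_row_system S r0 y1 y2 : section_row S r0 y1 y2 *m system y1 y2 = 0.
Proof.
rewrite /section_row mulmxBl -scalemxAl -!mulmxA mul_adj_mx mul_mx_scalar.
by rewrite -scalemxAr subrr.
Qed.

Lemma section_row_base S r0 y1 y2 :
  S *m system y1 y2 = 1%:M -> r0 *m system y1 y2 = 0 -> section_row S r0 y1 y2 = r0.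
Proof. by move=> SM r0M; rewrite /section_row SM r0M det1 scale1r !mul0mx subr0. Qed.

Lemma reg_section_row S r0 : reg_mx reg (fun t => section_row S r0 (z1 t) (z2 t)).
Proof.
have rM := reg_system; have rSM : reg_mx reg (fun t => S *m system (z1 t) (z2 t)).
  by apply: reg_mulmx => //; apply: reg_mx_const.
apply: reg_mxD => //.
  by apply: reg_mxZ => //; [apply: reg_det|apply: reg_mx_const].
apply: reg_mxN => //; apply: reg_mulmx => //; last exact: reg_mx_const.
apply: reg_mulmx => //; last exact: reg_adjugate.
by apply: reg_mulmx => //; apply: reg_mx_const.
Qed.

End RegularSystem.

Section Irreducibility.
Variables (K : numFieldType) (Q : quiver) (la la' nu nu' : dimvec Q).
Local Notation E1 := (triple K nu la).
Local Notation E2 := (triple K nu' la').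
Local Notation E := (triple K (dadd nu nu') (dadd la la')).
Local Notation N := #|entry_index (dadd nu nu') (dadd la la')|.

Definition block_fiber (z1 : E1) (z2 : E2) : set E :=
  [set block_triple z1 z2 (of_row r) | r in [set r : 'rV[K]_N | r *m system z1 z2 = 0]].

(** A vector space, any two points of which are joined by a line. *)
Lemma irreducible_block_fiber z1 z2 : irreducible (block_fiber z1 z2).
Proof.
apply: irreducible_by_curves.
  by exists (block_triple z1 z2 (of_row 0)), 0 => //=; rewrite mul0mx.
move=> _ _ [r0 /= r0M <-] [r1 /= r1M <-].
pose r (t : K) := (1 - t) *: r0 + t *: r1.
have lR := @line_functions_ring K.
have l1 : line_functions (fun=> 1 : K) by apply: reg_const.
exists (fun t => block_triple z1 z2 (of_row (r t))), (fun=> 1); split=> //.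
- apply: reg_triple_localization => //; apply: reg_block_triple => //.
  + by split=> *; apply: reg_mx_const.
  + by split=> *; apply: reg_mx_const.
  + by move=> a b; under eq_fun do rewrite !mxE; apply: line_affine.
- by rewrite /r subr0 subrr !scale0r !scale1r addr0 add0r.
- by rewrite oner_neq0.
- move=> t _; exists (r t) => //=.
  by rewrite mulmxDl -!scalemxAl r0M r1M !scaler0 addr0.
Qed.

Lemma block_section z1 z2 w : stable z2 -> block_fiber z1 z2 w ->
  exists S r0, w = block_triple z1 z2 (of_row (section_row S r0 z1 z2)).
Proof.
move=> st2 [r0 /= r0M <-]; have /row_fullP[S SM] := system_full z1 st2.
by exists S, r0; rewrite section_row_base.
Qed.

(** The fibration is treated in two steps, over C1 and then over C2, because
    the Zariski topology of a product is not the product topology: each step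
    needs sections polynomial in one triple, the other being fixed. *)
Lemma irreducible_blocks (C1 : set E1) (C2 : set E2) :
  (forall z2, C2 z2 -> stable z2) -> irreducible C1 -> irreducible C2 ->
  irreducible (\bigcup_(z1 in C1) \bigcup_(z2 in C2) block_fiber z1 z2).
Proof.
move=> stC2 irrC1 irrC2.
pose sec S r0 (z1 : E1) (z2 : E2) := block_triple z1 z2 (of_row (section_row S r0 z1 z2)).
have secF S r0 z1 z2 : block_fiber z1 z2 (sec S r0 z1 z2).
  by exists (section_row S r0 z1 z2) => //=; apply: section_row_system.
have closed1 A S r0 z2 : closed A -> closed [set z1 | A (sec S r0 z1 z2)].
  apply: (closed_preimage (s := fun z1 => sec S r0 z1 z2)).
  have regR := @regular_functions_ring K Q nu la.
  apply: reg_block_triple => //; [exact: reg_triple_id|by split=> *; apply: reg_mx_const|].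
  apply: reg_section_row => //; first exact: reg_triple_id.
  by split=> *; apply: reg_mx_const.
have closed2 A S r0 z1 : closed A -> closed [set z2 | A (sec S r0 z1 z2)].
  apply: (closed_preimage (s := fun z2 => sec S r0 z1 z2)).
  have regR := @regular_functions_ring K Q nu' la'.
  apply: reg_block_triple => //; [by split=> *; apply: reg_mx_const|exact: reg_triple_id|].
  apply: reg_section_row => //; last exact: reg_triple_id.
  by split=> *; apply: reg_mx_const.
apply: irreducible_fibration => // [z1 C1z1|A cA].
  apply: irreducible_fibration => // [z2 C2z2|A cA]; first exact: irreducible_block_fiber.
  exists (\bigcap_(Sr in setT) [set z2 | A (sec Sr.1 Sr.2 z1 z2)]).
    by apply: closed_bigI => Sr _; apply: closed2.
  move=> z2 C2z2; split=> [Az w Fw|FA [S r0] _]; last exact/FA/secF.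
  by have [S [r0 ->]] := block_section (stC2 _ C2z2) Fw; apply: (Az (S, r0)).
exists (\bigcap_(z2 in C2) \bigcap_(Sr in setT) [set z1 | A (sec Sr.1 Sr.2 z1 z2)]).
  by apply: closed_bigI => z2 _; apply: closed_bigI => Sr _; apply: closed1.
move=> z1 C1z1; split=> [Az w [z2 C2z2 Fw]|FA z2 C2z2 [S r0] _].
  by have [S [r0 ->]] := block_section (stC2 _ C2z2) Fw; apply: (Az z2 _ (S, r0)).
by apply: FA; exists z2 => //; apply: secF.
Qed.

End Irreducibility.

(** * Algebraic dependence of V on the triple *)

Section DiagonalBlocks.
Variables (K : fieldType) (Q : quiver) (la la' nu nu' : dimvec Q).
Local Notation E := (triple K (dadd nu nu') (dadd la la')).

Definition sub_triple (z : E) : triple K nu la :=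
  Triple (fun i j h => ulsubmx (tx z h : 'M_(nu i + nu' i, nu j + nu' j)))
         (fun i => ulsubmx (tf z i : 'M_(nu i + nu' i, la i + la' i))) (fun=> 0).

Definition quot_triple (z : E) : triple K nu' la' :=
  Triple (fun i j h => drsubmx (tx z h : 'M_(nu i + nu' i, nu j + nu' j)))
         (fun i => drsubmx (tf z i : 'M_(nu i + nu' i, la i + la' i))) (fun=> 0).

(** In the basis given by c, V lies in the span of the first vectors. *)
Definition triangularizes (c : graded_subspace K (dadd nu nu')) (z : E) :=
  invertible c /\ forall V, is_Vmax z V -> forall i,
    V i *m rsubmx (c i : 'M_(nu i + nu' i)) = 0.

(** In a basis adapted to V, the induced triples are the diagonal blocks, up
    to a choice of bases of V and of its quotient. *)
Lemma triangularizes_induced c (z : E) z1 z2 : Ztilde z -> triangularizes c z ->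
  induced z z1 z2 ->
  orb (sub_triple (gact c z)) = orb z1 /\ orb (quot_triple (gact c z)) = orb z2.
Proof.
move=> Zz [uc Vc] /(induced_extension_maps Zz)[iota [p [V [e mV Vi]]]].
have e' := extension_gact e uc; set z' := gact c z in e' *.
pose a i := iota i *m lsubmx (c i : 'M_(nu i + nu' i)).
have ic i : iota i *m c i = row_mx (a i) 0.
  rewrite -[c i](@hsubmxK _ _ (nu i) (nu' i)) mul_mx_row; congr row_mx.
  by apply/eqP; rewrite -submx0 -(eqmxMr _ (Vi i)) (Vc _ mV) sub0mx.
have ua : invertible a.
  move=> i; rewrite -row_free_unit; have := ext_free e' i.
  rewrite ic => /row_freeP[B]; rewrite -[B](@vsubmxK _ (nu i) (nu' i)) mul_row_col.
  by rewrite mul0mx addr0 => aB; apply/row_freeP; exists (usubmx B).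
pose b i := dsubmx (invmx (c i) *m p i : 'M_(nu i + nu' i, nu' i)).
have cp i : invmx (c i) *m p i = col_mx 0 (b i).
  rewrite -[LHS](@vsubmxK _ (nu i) (nu' i)); congr col_mx.
  have := ext_iota_p e' i; set B := invmx _ *m _.
  rewrite ic -{1}[B](@vsubmxK _ (nu i) (nu' i)) mul_row_col mul0mx addr0.
  by move=> /(congr1 (mulmx (invmx (a i)))); rewrite (mulKmx (ua i)) mulmx0.
have ub : invertible b.
  move=> i; rewrite -row_full_unit; have := ext_full e' i.
  rewrite cp => /row_fullP[B]; rewrite -[B](@hsubmxK _ _ (nu i) (nu' i)) mul_row_col.
  by rewrite mulmx0 add0r => aB; apply/row_fullP; exists (rsubmx B).
split; apply/esym/orb_eqP.
  exists a => //; apply: triple_ext => [i j h|i|i] /=; last by rewrite (ext_g1 e) mul0mx.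
    rewrite -[RHS]mulmxA; apply: (canRL (mulKmx (ua i))).
    have := ext_x1 e' h.
    rewrite !ic -[tx z' h](@submxK _ (nu i) (nu' i) (nu j) (nu' j)) mul_row_block.
    by rewrite mul_mx_row !mul0mx !addr0 => /eq_row_mx[].
  apply: (canRL (mulKmx (ua i))); have := ext_f1 e' i.
  rewrite !ic -[tf z' i](@submxK _ (nu i) (nu' i) (la i) (la' i)) mul_row_block.
  by rewrite !mul0mx !addr0 => /eq_row_mx[].
exists (fun i => invmx (b i)); first exact: invertible_inv.
apply: triple_ext => [i j h|i|i] /=; last by rewrite (ext_g2 e) mul0mx.
  rewrite invmxK; apply: (canRL (mulmxK (ub j))).
  have := ext_x2 e' h.
  rewrite !cp -[tx z' h](@submxK _ (nu i) (nu' i) (nu j) (nu' j)) mul_block_col.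
  by rewrite mul_col_mx !mulmx0 !add0r => /eq_col_mx[].
rewrite invmxK; have := ext_f2 e' i; rewrite !cp mul_col_mx /quot_tf.
rewrite -[tf z' i](@submxK _ (nu i) (nu' i) (la i) (la' i)) {1}/block_mx.
by rewrite -block_mxEv block_mxEh row_mxKr => /eq_col_mx[].
Qed.

End DiagonalBlocks.

Section Continuity.
Variables (K : numFieldType) (Q : quiver) (la la' nu nu' : dimvec Q).
Local Notation E := (triple K (dadd nu nu') (dadd la la')).
Local Notation reg := (@regular_functions K Q (dadd nu nu') (dadd la la')).
Let regR : function_ring reg := @regular_functions_ring _ _ _ _.

(** A polynomial family of covectors, the columns of N, that vanish on V at
    every triple of [Ztilde]. *)
Definition annihilator i m (N : E -> 'M[K]_(nu i + nu' i, m)) :=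
  reg_mx reg N /\ forall z V, @Ztilde _ _ la la' nu nu' z -> is_Vmax z V ->
    V i *m N z = 0.

(** Together with [annihilator_x], this yields the covectors which send a
    vector to its image under a path of x followed by f and the projection to
    W'; their common kernel is V. *)
Lemma annihilator_f i : annihilator (fun z : E => quot_tf z i).
Proof.
have [_ rf _] := @reg_triple_id K Q (dadd nu nu') (dadd la la').
split=> [a b|z V Zz [[_ fV _] _]]; last exact: fV.
by rewrite /quot_tf; under eq_fun do rewrite mxE; apply: rf.
Qed.

Lemma annihilator_x i j (h : hom i j) m (N : E -> 'M_(_, m)) :
  @annihilator j m N -> annihilator (fun z : E => tx z h *m N z).
Proof.
have [rx _ _] := @reg_triple_id K Q (dadd nu nu') (dadd la la').
move=> [rN VN]; split=> [|z V Zz mV]; first exact: reg_mulmx (rx _ _ h) rN.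
have [[xV _ _] _] := mV; have /submxP[D VD] := xV i j h.
by rewrite mulmxA VD -mulmxA (VN z V) // mulmx0.
Qed.

Lemma annihilator_row i m m' (N : E -> 'M_(_, m)) (N' : E -> 'M_(_, m')) :
  @annihilator i m N -> @annihilator i m' N' ->
  annihilator (fun z : E => row_mx (N z) (N' z)).
Proof.
move=> [rN VN] [rN' VN']; split=> [|z V Zz mV]; first exact: reg_row_mx.
by rewrite mul_mx_row VN // VN' // row_mx0.
Qed.

Lemma annihilator_mul i m m' (N : E -> 'M_(_, m)) (D : 'M_(m, m')) :
  @annihilator i m N -> annihilator (fun z : E => N z *m D).
Proof.
move=> [rN VN]; split=> [|z V Zz mV]; last by rewrite mulmxA (VN z V) // mul0mx.
by apply: reg_mulmx => //; apply: reg_mx_const.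
Qed.

(** A family of maximal rank at z0: adding columns to it cannot lower its
    kernel at z0. *)
Lemma annihilator_max (z0 : E) i : exists m (N : E -> 'M_(_, m)),
  @annihilator i m N /\ forall m' (N' : E -> 'M_(_, m')), annihilator N' ->
    kermx (N z0) *m N' z0 = 0.
Proof.
pose P k := `[< exists m (N : E -> 'M_(_, m)), @annihilator i m N /\ \rank (N z0) = k >].
have exP : exists k, P k.
  exists 0%N; apply/asboolP; exists 0%N, (fun=> 0); split; last by rewrite mxrank0.
  by split=> [|z V _ _]; [apply: reg_mx_const|rewrite mulmx0].
have boundP k : P k -> (k <= nu i + nu' i)%N.
  by move=> /asboolP[m [N [_ <-]]]; apply: rank_leq_row.
case: (ex_maxnP exP boundP) => k /asboolP[m [N [aN rN]]] maxk.
exists m, N; split=> // m' N' aN'.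
have /maxk : P (\rank (row_mx (N z0) (N' z0))).
  apply/asboolP; exists (m + m')%N, (fun z => row_mx (N z) (N' z)); split=> //.
  exact: annihilator_row.
rewrite -rN => le_rank.
have sker : (kermx (row_mx (N z0) (N' z0)) <= kermx (N z0))%MS.
  apply/sub_kermxP; have := mulmx_ker (row_mx (N z0) (N' z0)).
  by rewrite mul_mx_row -row_mx0 => /eq_row_mx[].
have : (kermx (N z0) <= kermx (row_mx (N z0) (N' z0)))%MS.
  by rewrite -(geq_leqif (mxrank_leqif_sup sker)) !mxrank_ker leq_sub2l.
by move=> /sub_kermxP; rewrite mul_mx_row -row_mx0 => /eq_row_mx[].
Qed.

(** At z0, the kernels of families of maximal rank form an admissible
    subspace, since multiplying a family by x gives another one. It contains
    V, so it is V by maximality. Hence suitable combinations of their columns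
    take the value p at z0; used as last columns of c, they make c(z) send V
    into the span of the first basis vectors at every z of [Ztilde] where c(z)
    is invertible. *)
Lemma local_triangularization (z0 : E) : Ztilde z0 ->
  exists c : E -> graded_subspace K (dadd nu nu'),
    [/\ forall i, reg_mx reg (fun z => c z i), invertible (c z0) &
        forall z, Ztilde z -> invertible (c z) -> triangularizes (c z) z].
Proof.
move=> Zz0; have [z1 [z2 [ind _ _]]] := Ztilde_induced Zz0.
have [iota [p [V [e mV Vi]]]] := induced_extension_maps Zz0 ind.
have [m [N NP]] : exists (m : vertex Q -> nat) (N : forall i, E -> 'M_(_, m i)),
    forall i, @annihilator i (m i) (N i) /\
      forall m' (N' : E -> 'M_(_, m')), annihilator N' -> kermx (N i z0) *m N' z0 = 0.
  exists (fun i => projT1 (cid (annihilator_max z0 i))).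
  exists (fun i => projT1 (cid (projT2 (cid (annihilator_max z0 i))))) => i.
  by case: (cid (annihilator_max z0 i)) => m /= ?; case: cid.
pose U i : 'M[K]_(dadd nu nu' i) := kermx (N i z0).
have aU : admissible z0 U.
  split=> [i j h|i|i].
  - apply/sub_kermxP; rewrite -mulmxA; have [aN _] := NP j.
    exact: (NP i).2 _ _ (annihilator_x h aN).
  - exact: (NP i).2 _ _ (annihilator_f i).
  - have [[_ _ gV] _] := mV; apply: submx_trans (gV i) _.
    by apply/sub_kermxP; have [[_ VN] _] := NP i; apply: VN.
(* 1 - N N^+ has its rows in the kernel of N, which is V, and p kills V *)
have Np i : N i z0 *m (pinvmx (N i z0) *m p i) = p i.
  apply/eqP; rewrite -subr_eq0 mulmxA -[X in _ - X]mul1mx -mulmxBl -oppr_eq0.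
  rewrite -mulNmx opprB; apply/eqP/sub_kermxP; rewrite (ext_exact e) -Vi.
  apply: submx_trans (mV.2 _ aU i); apply/sub_kermxP.
  by rewrite mulmxBl mul1mx mulmxKpV // subrr.
have [c0 [uc0 c0p _]] := extension_block_form e.
pose c (z : E) : graded_subspace K (dadd nu nu') := fun i =>
  row_mx (lsubmx (c0 i : 'M_(nu i + nu' i))) (N i z *m (pinvmx (N i z0) *m p i)).
exists c; split=> [i||z Zz uc].
- apply: reg_row_mx; first exact: reg_mx_const.
  by have [/(annihilator_mul (pinvmx (N i z0) *m p i))[]] := NP i.
- by move=> i; rewrite /c Np -c0p; apply: uc0.
- split=> // V' mV' i; rewrite row_mxKr.
  by have [/(annihilator_mul (pinvmx (N i z0) *m p i))[_ VN] _] := NP i; apply: VN mV'.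
Qed.

(** A polynomial that vanishes on B and not at a block of z0 in a local
    triangularizing basis pulls back to a rational function of z, whose
    numerator times denominator cuts out D. *)
Lemma block_separation (m l : dimvec Q) (part : E -> triple K m l)
    (B : set (triple K m l)) (z0 : E) :
  (forall (rg : set (E -> K)) (z : E -> E), reg_triple rg z ->
     function_ring rg -> reg_triple rg (fun t => part (z t))) ->
  closed B -> Ztilde z0 ->
  (forall c, triangularizes c z0 -> ~ B (part (gact c z0))) ->
  exists D, [/\ closed D, ~ D z0 & forall z, Ztilde z ->
    (forall c, triangularizes c z -> B (part (gact c z))) -> D z].
Proof.
move=> rpart cB Zz0 nB; have [c [rc uc0 tc]] := local_triangularization Zz0.
have [q [qB qz0]] := closed_separation cB (nB _ (tc _ Zz0 uc0)).
have [rd rz] := reg_gact regR rc (@reg_triple_id _ _ _ _); set d := fun t => _ in rd rz.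
have lR := localization_ring regR rd.
have [n [q' [rq' Eq]]] := reg_triple_meval lR q (rpart _ _ rz lR).
have dP z : d z != 0 <-> invertible (c z).
  split=> [/prodf_neq0 dz i|uc]; first by rewrite unitmxE unitfE; apply: dz.
  by apply/prodf_neq0 => i _; rewrite -unitfE -unitmxE; apply: uc.
exists [set z | d z * q' z = 0]; split.
- by apply: closed_regular_zeros; apply: regM.
- have d0 : d z0 != 0 by apply/dP.
  by apply/eqP; rewrite mulf_neq0 // -Eq // mulf_neq0 // expf_neq0.
- move=> z Zz Bz /=; have [->|dz] := eqVneq (d z) 0; first by rewrite mul0r.
  by rewrite -Eq // qB ?mul0r ?mulr0 //; apply/Bz/tc => //; apply/dP.
Qed.

Lemma reg_sub_triple T (rg : set (T -> K)) (z : T -> E) :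
  reg_triple rg z -> function_ring rg -> reg_triple rg (fun t => sub_triple (z t)).
Proof.
move=> [rx rf _] rR; split=> [i j h|i|i]; last exact: reg_mx_const;
  by move=> a b; under eq_fun do rewrite !mxE; first [exact: rx|exact: rf].
Qed.

Lemma reg_quot_triple T (rg : set (T -> K)) (z : T -> E) :
  reg_triple rg z -> function_ring rg -> reg_triple rg (fun t => quot_triple (z t)).
Proof.
move=> [rx rf _] rR; split=> [i j h|i|i]; last exact: reg_mx_const;
  by move=> a b; under eq_fun do rewrite !mxE; first [exact: rx|exact: rf].
Qed.

End Continuity.

(** * The bijection on components *)

Section TensorBijection.
Variables (K : numFieldType) (Q : quiver) (la la' nu nu' : dimvec Q).
Local Notation E1 := (triple K nu la).
Local Notation E2 := (triple K nu' la').
Local Notation E := (triple K (dadd nu nu') (dadd la la')).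
Local Notation O1 := (orbit_space K nu la).
Local Notation O2 := (orbit_space K nu' la').
Local Notation O := (orbit_space K (dadd nu nu') (dadd la la')).
Local Notation Zt := (@Ztilde K Q la la' nu nu').
Local Notation Ztf := (@Ztilde_frak K Q la la' nu nu').

Lemma block_fiber_Ztilde (z1 : E1) (z2 : E2) w : L_semi z1 -> L_semi z2 ->
  block_fiber z1 z2 w -> Zt w /\ induced w z1 z2.
Proof.
move=> L1 L2 [r /= /systemP off0 <-].
have [[mu1 _] g1 _] := L1; have [[mu2 _] g2 _] := L2.
apply: extension_Ztilde L1 L2 (extension_block_triple _ g1 g2) => i.
by rewrite moment_map_block_triple // mu1 mu2 off0 block_mx0.
Qed.

Lemma Ztilde_block_fiber (z : E) z1 z2 : Zt z -> induced z z1 z2 ->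
  exists2 w, block_fiber z1 z2 w & orb w = orb z.
Proof.
move=> Zz ind; have [L1 L2] := induced_L_semi Zz ind.
have [iota [p [V [e mV Vi]]]] := induced_extension_maps Zz ind.
have [c [uc _ cE]] := extension_block_form e.
exists (gact c z); last exact: orb_gact.
have [[mu1 _] g1 _] := L1; have [[mu2 _] g2 _] := L2.
have [r rE] := of_row_surj (gact c z).
exists r; last by rewrite rE -cE.
apply/systemP => i; rewrite rE.
have [[[[mu0 _ _] _] _] _] := Zz.
have := M_circ_gact uc mu0 i; rewrite cE moment_map_block_triple // -cE.
by rewrite -(block_mx0 _ (nu i) (nu' i) (nu i) (nu' i)) => /eq_block_mx[].
Qed.

(** The class of the zero triple, which exists in every dimension, makes the
    map total. *)
Definition tensor_map (o : O) : O1 * O2 :=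
  match pselect (exists zz : E1 * E2, exists z,
      [/\ orb z = o, Zt z & induced z zz.1 zz.2]) with
  | left ex => (orb (projT1 (cid ex)).1, orb (projT1 (cid ex)).2)
  | right _ => (orb (Triple (fun _ _ _ => 0) (fun=> 0) (fun=> 0)),
                orb (Triple (fun _ _ _ => 0) (fun=> 0) (fun=> 0)))
  end.

Lemma tensor_mapE (z : E) z1 z2 : Zt z -> induced z z1 z2 ->
  tensor_map (orb z) = (orb z1, orb z2).
Proof.
move=> Zz ind; rewrite /tensor_map; case: pselect => [ex|[]]; last by exists (z1, z2), z.
case: (cid ex) => -[y1 y2] [z' [z'z Zz' ind']] /=.
by have [-> ->] := induced_unique Zz (induced_orb Zz' z'z ind') ind.
Qed.

Lemma tensor_map_induced : is_induced_map tensor_map.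
Proof.
move=> z Zz; split.
  by have [z1 [z2 [ind _ _]]] := Ztilde_induced Zz; exists z1, z2.
move=> z1 z2 ind; have [L1 L2] := induced_L_semi Zz ind.
by split=> //; apply: tensor_mapE.
Qed.

Lemma triangularizes_tensor_map c (z : E) : Zt z -> triangularizes c z ->
  tensor_map (orb z) = (orb (sub_triple (gact c z)), orb (quot_triple (gact c z))).
Proof.
move=> Zz tc; have [z1 [z2 [ind _ _]]] := Ztilde_induced Zz.
by have [-> ->] := triangularizes_induced Zz tc ind; apply: tensor_mapE.
Qed.

(** A set of orbits is relatively closed when each triple outside it is
    separated from it by a closed set, here obtained from the rational
    expression of the diagonal block. *)
Lemma closed_preimages_component (m l : dimvec Q) (f : O -> orbit_space K m l)
    (part : E -> triple K m l) :
  (forall (rg : set (E -> K)) (z : E -> E), reg_triple rg z ->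
     function_ring rg -> reg_triple rg (fun t => part (z t))) ->
  (forall c z, Zt z -> triangularizes c z -> f (orb z) = orb (part (gact c z))) ->
  closed_preimages Ztf f.
Proof.
move=> rpart fE A cA.
have [||A' cA' A'E] := @relatively_closed_orbits K Q _ _ Zt
    [set z | Zt z /\ A (f (orb z))].
- by move=> z z' zz' [Zz Az]; split; [apply: Ztilde_orb zz' Zz|rewrite -zz'].
- move=> z Zz nBz.
  have [|D [cD nDz BD]] := block_separation rpart ((closed_orbP A).1 cA) Zz.
    by move=> c tc /= Ac; apply: nBz; split=> //; rewrite (fE c).
  exists D; split=> // y [Zy Ay]; apply: BD => // c tc /=.
  by rewrite -fE.
by exists A' => // _ [z Zz <-]; rewrite A'E //; split=> [[]|].
Qed.

(** Each orbit of [Ztilde_frak] has block triangular representatives. *)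
Lemma tensor_map_preimage (C1 : set O1) (C2 : set O2) :
  C1 `<=` @L_frak K Q nu la -> C2 `<=` @L_frak K Q nu' la' ->
  Ztf `&` tensor_map @^-1` (C1 `*` C2) =
  [set orb z | z in \bigcup_(z1 in @orb K Q nu la @^-1` C1)
                    \bigcup_(z2 in @orb K Q nu' la' @^-1` C2) block_fiber z1 z2].
Proof.
move=> sC1 sC2.
have L1 (z1 : E1) : C1 (orb z1) -> L_semi z1.
  by move=> /sC1[y Ly yz]; apply: L_semi_orb yz Ly.
have L2 (z2 : E2) : C2 (orb z2) -> L_semi z2.
  by move=> /sC2[y Ly yz]; apply: L_semi_orb yz Ly.
apply/seteqP; split=> [o [[z Zz <-] []]|_ [w [z1 Cz1 [z2 Cz2 Fw]] <-]].
  have [z1 [z2 [ind _ _]]] := Ztilde_induced Zz.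
  rewrite (tensor_mapE Zz ind) /= => Cz1 Cz2.
  have [w Fw wz] := Ztilde_block_fiber Zz ind.
  by exists w => //; exists z1 => //; exists z2.
have [Zw ind] := block_fiber_Ztilde (L1 _ Cz1) (L2 _ Cz2) Fw.
by split; [exists w|rewrite /= (tensor_mapE Zw ind)].
Qed.

Lemma tensor_map_components :
  set_bij (Irr (@L_frak K Q nu la) `*` Irr (@L_frak K Q nu' la')) (Irr Ztf)
          (fun X => Ztf `&` tensor_map @^-1` (X.1 `*` X.2)).
Proof.
apply: fibred_components_bij.
- move=> _ [z Zz <-]; have [z1 [z2 [ind _ _]]] := Ztilde_induced Zz.
  rewrite (tensor_mapE Zz ind); have [L1 L2] := induced_L_semi Zz ind.
  by split; [exists z1|exists z2].
- move=> _ _ [z1 L1 <-] [z2 L2 <-].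
  have Fw : block_fiber z1 z2 (block_triple z1 z2 (of_row 0)).
    by exists 0 => //=; rewrite mul0mx.
  have [Zw ind] := block_fiber_Ztilde L1 L2 Fw.
  exists (orb (block_triple z1 z2 (of_row 0))); last exact: tensor_mapE.
  by exists (block_triple z1 z2 (of_row 0)).
- apply: (closed_preimages_component (part := @sub_triple K Q la la' nu nu')).
    exact: reg_sub_triple.
  by move=> c z Zz tc; rewrite (triangularizes_tensor_map Zz tc).
- apply: (closed_preimages_component (part := @quot_triple K Q la la' nu nu')).
    exact: reg_quot_triple.
  by move=> c z Zz tc; rewrite (triangularizes_tensor_map Zz tc).
- move=> C1 C2 sC1 sC2 irrC1 irrC2; rewrite tensor_map_preimage //.
  apply: irreducible_orb_image; apply: irreducible_blocks.
  + by move=> z2 /sC2[y Ly yz]; have [[]] := L_semi_orb yz Ly.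
  + exact: irreducible_orb_preimage.
  + exact: irreducible_orb_preimage.
Qed.

End TensorBijection.

Theorem theorem2p23 (R : realType) (Q : quiver) (la la' nu nu' : dimvec Q) :
  exists T : orbit_space R[i] (dadd nu nu') (dadd la la') ->
             orbit_space R[i] nu la * orbit_space R[i] nu' la',
    is_induced_map T /\
    set_bij (Irr (@L_frak R[i] Q nu la) `*` Irr (@L_frak R[i] Q nu' la'))
            (Irr (@Ztilde_frak R[i] Q la la' nu nu'))
            (fun X => @Ztilde_frak R[i] Q la la' nu nu' `&`
                      T @^-1` (X.1 `*` X.2)).
Proof.
exists (@tensor_map R[i] Q la la' nu nu').
by split; [apply: tensor_map_induced|apply: tensor_map_components].
Qed.
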